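(* Let $t>0$ and $q=e^{-t}$, and let $X$ be $\mathbf{P}^1$ or $\mathbf{P}^2$ with the toric Kähler form whose moment polytope is $P=[0,t]$, respectively $P=\{(x_1,x_2)\in\mathbf{R}^2: x_1\ge 0,\ x_2\ge 0,\ x_1+x_2\le t\}$. Let $(\check X,W)$ be the mirror Landau-Ginzburg model of $X$. Let $L_0$ be the Lagrangian torus fiber of the moment map over the center of mass $x_0$ of $P$, equipped with the trivial flat $U(1)$-connection $\nabla$. Let $L$ be the deformed Lagrangian, $\Psi_{L,\nabla}$ the associated matrix-valued function, and $\mathcal F$ the SYZ transformation (fiberwise Fourier series), all as defined in the context. Then the SYZ transformation of $\Psi_{L,\nabla}$ gives a matrix factorization $M_0$ of $(\check X,W)$ which is mirror to the A-brane $(L_0,\nabla)$. Explicitly: (a) If $X=\mathbf{P}^1$, then $$\mathcal F(\Psi_{L,\nabla})=M_0:=\begin{pmatrix}0 & z-\sqrt q\\ 1-\frac{\sqrt q}{z} & 0\end{pmatrix},$$ $M_0^2=(W(z)-W(\sqrt q))\,\mathrm{Id}$, and $M_0$ is the matrix factorization corresponding (under Orlov's equivalence) to the structure sheaf of the point $z_0=e^{-x_0}=\sqrt q\in\check X$, which is the point mirror to $(L_0,\nabla)$. (b) If $X=\mathbf{P}^2$, then $$\mathcal F(\Psi_{L,\nabla})=M_0:=\begin{pmatrix} 0 & 0 & z_1-q^{1/3} & z_2-\frac{q^{2/3}}{z_1}\\ 0 & 0 & -\left(1-\frac{q^{1/3}}{z_2}\right) & 1-\frac{q^{1/3}}{z_1}\\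 1-\frac{q^{1/3}}{z_1} & -\left(z_2-\frac{q^{2/3}}{z_1}\right) & 0 & 0\\ 1-\frac{q^{1/3}}{z_2} & z_1-q^{1/3} & 0 & 0\end{pmatrix},$$ $M_0^2=(W(z_1,z_2)-W(q^{1/3},q^{1/3}))\,\mathrm{Id}$, and $M_0$ is the matrix factorization corresponding (under Orlov's equivalence) to the structure sheaf of the point $z_0=e^{-x_0}=(q^{1/3},q^{1/3})\in\check X$, which is the point mirror to $(L_0,\nabla)$.
   Context: **Mirror Landau-Ginzburg models.** Put $q=e^{-t}\in(0,1)$. For $X=\mathbf{P}^1$: $\check X=\{z\in\mathbf{C}^*: q<|z|<1\}$ and $W=z+\frac{q}{z}$. For $X=\mathbf{P}^2$: $\check X=\{(z_1,z_2)\in(\mathbf{C}^* )^2: |z_1|<1,\ |z_2|<1,\ |z_1z_2|>q\}$ and $W=z_1+z_2+\frac{q}{z_1z_2}$. The coordinate ring $R$ is $\mathbf{C}[z^{\pm1}]$, respectively $\mathbf{C}[z_1^{\pm1},z_2^{\pm1}]$. **SYZ mirror points.** $\check X$ is the moduli space of pairs $(L_x,\nabla_y)$, where $L_x$ is the moment-map fiber over $x\in\mathrm{Int}(P)$ and $\nabla_y$ is the flat $U(1)$-connection on the trivial line bundle over $L_x$ with parameter $y\in(\mathbf{R}/2\pi\mathbf{Z})^n$, $n=\dim_{\mathbf C}X$. The pair $(L_x,\nabla_y)$ corresponds to the point with coordinates $z_j=\exp(-x_j+iy_j)$. The center of mass is $x_0=t/2$ for $\mathbf{P}^1$ and $x_0=(t/3,t/3)$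 for $\mathbf{P}^2$. The trivial connection is $y=0$, so the mirror point of $(L_0,\nabla)$ is $z_0=e^{-x_0}$. **Matrix factorizations and mirror.** A matrix factorization of $(\check X,W)$ is an even-dimensional square matrix $M=\begin{pmatrix}0&F\\ G&0\end{pmatrix}$, with square blocks $F,G$ of equal size and entries in $R$, such that $M^2=(W-\lambda)\mathrm{Id}$ for some $\lambda\in\mathbf{C}$. Under Orlov's equivalence between matrix factorizations of $W-\lambda$ and the category of singularities $D_{Sg}=D^b(\mathrm{mod}\,R/(W-\lambda))/\mathrm{Perf}$, $M$ is sent to the $R/(W-\lambda)$-module $\mathrm{Coker}(F)$. For $\lambda=W(z_0)$, $M$ corresponds to the structure sheaf of $z_0$ if $\mathrm{Coker}(F)$ is isomorphic in $D_{Sg}$ to the skyscraper module $R/\mathfrak m_{z_0}$, where $\mathfrak m_{z_0}$ is the maximal ideal of $z_0$. ''$M_0$ is mirror to $(L_0,\nabla)$'' means that $M_0$ corresponds in this sense to the structure sheaf of the point $z_0\in\check X$ mirror to $(L_0,\nabla)$. **SYZ transformation.** For a matrix-valued function $\Psi$ on $U\times\mathbf{Z}^n$, with $U\subset\mathrm{Int}(P)$ open and $\Psi(x,\cdot)$ finitely supported, set $$\mathcal F(\Psi)(x,y)=\sum_{v\in\mathbf{Z}^n}\Psi(x,v)\,e^{i\langle v,y\rangle},$$ regarded as a function of $z_j=\exp(-x_j+iy_j)$ on the part of $\check X$ lying over $U$. The equalities in the claim are equalities of functions there, and the right-hand sides are Laurent polynomials, defined on all of $\check X$. **The Lagrangian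 $L$ and the function $\Psi_{L,\nabla}$ for $\mathbf{P}^1$.** Use Darboux coordinates $(x,u)\in(0,t)\times\mathbf{R}/2\pi\mathbf{Z}$ with $\omega=dx\wedge du$. $L$ is the image of $\tau:[0,3]\to\mathbf{P}^1$ with $\tau(s)=((1-s)t/2,0)$ for $0\le s\le1$, $\tau(s)=((s-1)t/2,0)$ for $1\le s\le2$, and $\tau(s)=(t/2,2\pi(s-2))$ for $2\le s\le3$. It is the limit of embedded Lagrangian circles $L_\epsilon$ Hamiltonian isotopic to $L_0$, obtained by slightly separating the two copies of the zero section and smoothing corners. Let $U=(0,t/2)$. For $x\in U$, $L$ (more precisely $L_\epsilon$) meets $L_x$ in two points $+,-$. For $a,b\in\{+,-\}$, $\Psi^{a,b}_{L,\nabla}(x,[\gamma])$ is the signed count, weighted by $e^{-\text{symplectic area}}$ (areas taken in the limit $L_\epsilon\to L$; the holonomy of the trivial connection is $1$), of nontrivial holomorphic disks sending $-1\mapsto a$, $1\mapsto b$, the upper half of $\partial D^2$ to $L$, and the lower half to $L_x$ in the class $[\gamma]\in\pi_1(L_x;a,b)\cong\mathbf{Z}$. The identification with $\mathbf{Z}$ is such that the minor arcs have class $0$, the major arc from $+$ to $-$ has class $1$, and the major arc from $-$ to $+$ has class $-1$. There are four such disks, with limiting areas $x$ (major arc) and $t/2$ (minor arc) for $(a,b)=(+,-)$, and $0$ (minor arc) and $t/2-x$ (major arc) for $(a,b)=(-,+)$. Including orientation signs, the values are: - $\Psi^{+,-}(x,1)=e^{-x}$ and $\Psi^{+,-}(x,0)=-\sqrt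 q$; - $\Psi^{-,+}(x,0)=1$ and $\Psi^{-,+}(x,-1)=-\sqrt q/e^{-x}$; - all other values are $0$, and $\Psi^{a,a}=0$. Set $\Psi_{L,\nabla}=\begin{pmatrix}0&\Psi^{+,-}\\ \Psi^{-,+}&0\end{pmatrix}$. **The Lagrangian $L$ and the function $\Psi_{L,\nabla}$ for $\mathbf{P}^2$.** Use Darboux coordinates $(x_1,x_2,u_1,u_2)$ with $\omega=dx_1\wedge du_1+dx_2\wedge du_2$. $L$ is the image of $\tau\times\tau:[0,3]^2\to\mathbf{C}^2\subset\mathbf{P}^2$, where $\tau$ is defined as for $\mathbf{P}^1$ but with $t/2$ replaced by $t/3$. It is a multi-section with four sheets over $U=(0,t/3)\times(0,t/3)$. For $x\in U$ the four intersection points of $L$ with $L_x$ (regarded as distinct, by slightly separating the sheets) are labeled $++,-+,+-,--$. The entries $\Psi^{a,b}_{L,\nabla}(x,v)$, for $v\in\mathbf{Z}^2\cong\pi_1(L_x;a,b)$, are signed sums of $e^{-\text{area}}$ over a prescribed list of ''permissible'' pairs of paths in $L$ and $L_x$ (a heuristic count of holomorphic disks with boundary on $L\cup L_x$, with signs assigned by hand). They are defined by the following values, all values not listed being $0$: - $\Psi^{++,-+}$ and $\Psi^{+-,--}$: $e^{-x_1}$ at $v=(1,0)$ and $-q^{1/3}$ at $v=(0,0)$. - $\Psi^{++,+-}$: $e^{-x_2}$ at $(0,1)$ and $-q^{2/3}/e^{-x_1}$ at $(-1,0)$. - $\Psi^{-+,--}$: $-e^{-x_2}$ at $(0,1)$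 and $q^{2/3}/e^{-x_1}$ at $(-1,0)$. - $\Psi^{--,-+}$: $-1$ at $(0,0)$ and $q^{1/3}/e^{-x_2}$ at $(0,-1)$. - $\Psi^{+-,++}$: $1$ at $(0,0)$ and $-q^{1/3}/e^{-x_2}$ at $(0,-1)$. - $\Psi^{--,+-}$ and $\Psi^{-+,++}$: $1$ at $(0,0)$ and $-q^{1/3}/e^{-x_1}$ at $(-1,0)$. Set $$\Psi_{L,\nabla}=\begin{pmatrix}0&0&\Psi^{++,-+}&\Psi^{++,+-}\\ 0&0&\Psi^{--,-+}&\Psi^{--,+-}\\ \Psi^{-+,++}&\Psi^{-+,--}&0&0\\ \Psi^{+-,++}&\Psi^{+-,--}&0&0\end{pmatrix}.$$ *)

(* Defs.v *)
From HB Require Import structures.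
From mathcomp Require Import all_boot all_order all_algebra finmap.
From mathcomp Require Import generic_quotient ring_quotient complex zify.
From mathcomp Require Import all_classical all_reals all_analysis.

Set Implicit Arguments.
Unset Strict Implicit.
Unset Printing Implicit Defensive.

Import Order.TTheory GRing.Theory Num.Theory.
Import numFieldNormedType.Exports.

Local Open Scope classical_set_scope.
Local Open Scope ring_scope.
Local Open Scope complex_scope.
Local Open Scope quotient_scope.

(** * Laurent polynomials: the group algebra of [Z^n] *)

Section Laurent.
Context (C : comNzRingType) (n : nat).
Implicit Types (u v : 'rV[int]_n).

Definition finsupp_fun : {pred 'rV[int]_n -> C} :=
  fun f => `[< finite_set [set v | f v != 0] >].

(* [p : laurent] stands for the sum over v of (p v) z_1^v_1 ... z_n^v_n. *)
Record laurent := Laurent { lcoef :> 'rV[int]_n -> C; _ : lcoef \in finsupp_fun }.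

HB.instance Definition _ := [isSub for lcoef].
HB.instance Definition _ := [Choice of laurent by <:].

Lemma finsupp_fun_zmod : zmod_closed finsupp_fun.
Proof.
split=> [|f g /asboolP ff /asboolP fg]; apply/asboolP.
  by rewrite (_ : [set _ | _] = set0) //; apply/seteqP; split=> // v /=; rewrite eqxx.
apply: (@sub_finite_set _ _ ([set v | f v != 0] `|` [set v | g v != 0])); last first.
  by rewrite finite_setU.
move=> v /= nz; apply: contrapT => /not_orP[/negP/negPn/eqP f0 /negP/negPn/eqP g0].
move: nz; have -> : (f - g) v = f v - g v by [].
by rewrite f0 g0 subr0 eqxx.
Qed.

HB.instance Definition _ :=
  GRing.isZmodClosed.Build ('rV[int]_n -> C) finsupp_fun finsupp_fun_zmod.
HB.instance Definition _ := [SubChoice_isSubZmodule of laurent by <:].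

Lemma laurentP (p q : laurent) : (forall v, p v = q v) <-> p = q.
Proof. by split=> [pq|-> //]; apply/val_inj/funext. Qed.

Lemma lcoefD (p q : laurent) v : (p + q) v = p v + q v. Proof. by []. Qed.
Lemma lcoefN (p : laurent) v : (- p) v = - p v. Proof. by []. Qed.
Lemma lcoef0 v : (0 : laurent) v = 0. Proof. by []. Qed.

Definition lsupp (p : laurent) : seq 'rV[int]_n := fset_set [set v | p v != 0].

Lemma lsupp_uniq p : uniq (lsupp p). Proof. exact: fset_uniq. Qed.

Lemma mem_lsupp p v : (v \in lsupp p) = (p v != 0).
Proof.
have fp : finite_set [set v | p v != 0] by apply/asboolP; case: p.
rewrite /lsupp in_fset_set //.
by apply/idP/idP; rewrite inE.
Qed.

Definition lmul_fun (p q : laurent) v : C :=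
  \sum_(u \in [set: 'rV[int]_n]) p u * q (v - u).

Lemma fsum_seq (T : nmodType) (F : 'rV[int]_n -> T) (s : seq 'rV[int]_n) :
  uniq s -> (forall v, v \notin s -> F v = 0) ->
  \sum_(v \in [set: 'rV[int]_n]) F v = \sum_(v <- s) F v.
Proof.
move=> us sF; rewrite (fsbigE s _ us) //; last by move=> v _; exact: sF.
by under eq_bigl do rewrite in_setT.
Qed.

Lemma lmul_fun_seq p q v s : uniq s -> {subset lsupp p <= s} ->
  lmul_fun p q v = \sum_(u <- s) p u * q (v - u).
Proof.
move=> us ps; apply: fsum_seq => // u us'.
have: u \notin lsupp p by apply: contra us' => /ps.
by rewrite mem_lsupp negbK => /eqP->; rewrite mul0r.
Qed.

Lemma lmul_fun_seqr p q v s : uniq s -> {subset lsupp q <= s} ->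
  lmul_fun p q v = \sum_(u <- s) p (v - u) * q u.
Proof.
move=> us qs.
have us' : uniq [seq v - u | u <- s].
  by rewrite map_inj_uniq // => a b /addrI /oppr_inj.
rewrite /lmul_fun (fsum_seq us').
  by rewrite big_map; apply: eq_bigr => u _; rewrite subKr.
move=> u us''; have: v - u \notin lsupp q.
  by apply: contra us'' => /qs h; apply/mapP; exists (v - u) => //; rewrite subKr.
by rewrite mem_lsupp negbK => /eqP->; rewrite mulr0.
Qed.

Definition lmul_supp (p q : laurent) :=
  undup [seq a + b | a <- lsupp p, b <- lsupp q].

Lemma lmul_suppP p q v : v \notin lmul_supp p q -> lmul_fun p q v = 0.
Proof.
move=> vpq; rewrite (lmul_fun_seq _ _ (lsupp_uniq p)) // big_seq big1 // => u up.
have : v - u \notin lsupp q.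
  apply: contra vpq => vq; rewrite mem_undup; apply/allpairsP; exists (u, v - u).
  by split=> //=; rewrite addrC subrK.
by rewrite mem_lsupp negbK => /eqP->; rewrite mulr0.
Qed.

Lemma lmul_fun_finsupp p q : lmul_fun p q \in finsupp_fun.
Proof.
apply/asboolP; apply: (@sub_finite_set _ _ [set` lmul_supp p q]).
  by move=> v /=; apply: contra_neqT; exact: lmul_suppP.
exact: finite_seq.
Qed.

Definition lmul p q := Laurent (lmul_fun_finsupp p q).

Lemma lterm_finsupp c v : (fun u => c *+ (u == v)) \in finsupp_fun.
Proof.
apply/asboolP; apply: (@sub_finite_set _ _ [set v]); last exact: finite_set1.
by move=> u /=; have [//|_] := eqVneq u v; rewrite mulr0n eqxx.
Qed.

(* The term c z^v. *)
Definition lterm c v : laurent := Laurent (lterm_finsupp c v).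
Definition lmono v : laurent := lterm 1 v.

Lemma lmulC : commutative lmul.
Proof.
move=> p q; apply/laurentP => v /=.
rewrite (lmul_fun_seq _ _ (lsupp_uniq p)) // (lmul_fun_seqr _ _ (lsupp_uniq p)) //.
by apply: eq_bigr => u _; rewrite mulrC.
Qed.

Lemma lmul_shift (T : nmodType) (F : 'rV[int]_n -> 'rV[int]_n -> T) (p q : laurent) w :
    w \in lsupp p -> (forall v, v \notin lsupp q -> F w v = 0) ->
  \sum_(u <- lmul_supp p q) F w (u - w) = \sum_(u <- lsupp q) F w u.
Proof.
move=> wp F0; rewrite -(fsum_seq (lsupp_uniq q) F0).
have us : uniq [seq u - w | u <- lmul_supp p q].
  by rewrite map_inj_uniq ?undup_uniq // => a b /addIr.
rewrite (fsum_seq us) ?big_map // => u uP.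
apply: F0; apply: contra uP => uq; apply/mapP; exists (w + u).
  by rewrite mem_undup; apply/allpairsP; exists (w, u).
by rewrite addrAC subrr add0r.
Qed.

Lemma lmulA : associative lmul.
Proof.
move=> p q r; apply/laurentP => v /=.
have spq : {subset lsupp (lmul p q) <= lmul_supp p q}.
  by move=> u; rewrite mem_lsupp; apply: contra_neqT; exact: lmul_suppP.
rewrite [RHS](lmul_fun_seq _ _ (undup_uniq _) spq).
rewrite (lmul_fun_seq _ _ (lsupp_uniq p)) //.
under [RHS]eq_bigr do
  rewrite /= (lmul_fun_seq _ _ (lsupp_uniq p)) // mulr_suml.
rewrite [RHS]exchange_big /= big_seq [RHS]big_seq; apply: eq_bigr => w wp.
rewrite (lmul_fun_seq _ _ (lsupp_uniq q)) // mulr_sumr.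
pose F w u := p w * q u * r (v - (u + w)).
rewrite [RHS](_ : _ = \sum_(u <- lmul_supp p q) F w (u - w)); last first.
  by apply: eq_bigr => u _; rewrite /F subrK.
rewrite lmul_shift //; last first.
  by move=> u; rewrite mem_lsupp negbK /F => /eqP->; rewrite mulr0 mul0r.
by apply: eq_bigr => u _; rewrite /F mulrA [u + w]addrC opprD addrA.
Qed.

Lemma lsupp_term c v : {subset lsupp (lterm c v) <= [:: v]}.
Proof. by move=> u; rewrite mem_lsupp /= inE; have [//|_] := eqVneq u v; rewrite mulr0n eqxx. Qed.

Lemma lmul1 : left_id (lmono 0) lmul.
Proof.
move=> p; apply/laurentP => v /=.
rewrite (@lmul_fun_seq _ _ _ [:: 0] _ (@lsupp_term 1 0)) // big_seq1 /=.
by rewrite eqxx mul1r subr0.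
Qed.

Lemma lmulDl : left_distributive lmul +%R.
Proof.
move=> p q r; apply/laurentP => v; rewrite lcoefD /=.
rewrite !(@lmul_fun_seqr _ r _ _ (lsupp_uniq r)) // -big_split /=.
by apply: eq_bigr => u _; rewrite -mulrDl.
Qed.

Lemma lmono0_neq0 : lmono 0 != 0.
Proof.
by apply/eqP => /laurentP /(_ 0); rewrite lcoef0 /= eqxx; apply/eqP/oner_neq0.
Qed.

HB.instance Definition _ := GRing.Zmodule_isComNzRing.Build laurent
  lmulA lmulC lmul1 lmulDl lmono0_neq0.

Definition lconst (c : C) : laurent := lterm c 0.

Definition lvar (j : 'I_n) : laurent := lmono (delta_mx 0 j).
Definition lvarV (j : 'I_n) : laurent := lmono (- delta_mx 0 j).

End Laurent.

Section Eval.
Context (C : fieldType) (n : nat).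

Definition lmono_at (z : 'rV[C]_n) (v : 'rV[int]_n) : C :=
  \prod_(j < n) (z 0 j) ^ (v 0 j).

Definition leval (z : 'rV[C]_n) (p : laurent C n) : C :=
  \sum_(v \in [set: 'rV[int]_n]) p v * lmono_at z v.

Record torus :=
  Torus { tpoint :> 'rV[C]_n; _ : [forall j, tpoint 0 j != 0] }.

Lemma torus_neq0 (z : torus) j : z 0 j != 0.
Proof. by case: z => z /= /forallP. Qed.

Lemma lmono_atD (z : torus) u v :
  lmono_at z (u + v) = lmono_at z u * lmono_at z v.
Proof.
rewrite /lmono_at -big_split; apply: eq_bigr => j _ /=.
by rewrite mxE expfzDr ?torus_neq0.
Qed.

Lemma lmono_at0 (z : 'rV[C]_n) : lmono_at z 0 = 1.
Proof. by rewrite /lmono_at big1 // => j _; rewrite mxE expr0z. Qed.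

Lemma leval_seq z (p : laurent C n) s : uniq s -> {subset lsupp p <= s} ->
  leval z p = \sum_(v <- s) p v * lmono_at z v.
Proof.
move=> us ps; apply: fsum_seq => // v vs.
have: v \notin lsupp p by apply: contra vs => /ps.
by rewrite mem_lsupp negbK => /eqP->; rewrite mul0r.
Qed.

Lemma leval_term z c v : leval z (lterm c v) = c * lmono_at z v.
Proof.
rewrite (@leval_seq _ _ [:: v]) //; last exact: lsupp_term.
by rewrite big_seq1 /= eqxx.
Qed.

Lemma leval_is_additive z : zmod_morphism (leval z).
Proof.
move=> p q; pose s := undup (lsupp p ++ lsupp q).
have sp : {subset lsupp p <= s} by move=> v vp; rewrite mem_undup mem_cat vp.
have sq : {subset lsupp q <= s} by move=> v vq; rewrite mem_undup mem_cat vq orbT.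
have spq : {subset lsupp (p - q) <= s}.
  move=> v; rewrite mem_lsupp lcoefD lcoefN; apply: contra_neqT.
  rewrite mem_undup mem_cat negb_or !mem_lsupp !negbK => /andP[/eqP-> /eqP->].
  by rewrite subr0.
rewrite !(@leval_seq _ _ s) ?undup_uniq // -sumrB /=.
by apply: eq_bigr => v _; rewrite -mulrBl.
Qed.

HB.instance Definition _ z := GRing.isZmodMorphism.Build
  (laurent C n) C (leval z) (leval_is_additive z).

Lemma leval_is_monoid_morphism (z : torus) : monoid_morphism (leval z).
Proof.
split=> [|p q]; first by rewrite leval_term lmono_at0 mulr1.
have spq : {subset lsupp (p * q) <= lmul_supp p q}.
  by move=> u; rewrite mem_lsupp; apply: contra_neqT; exact: lmul_suppP.
rewrite (leval_seq z (undup_uniq _) spq) (leval_seq z (lsupp_uniq p)) // (leval_seq z (lsupp_uniq q)) //.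
under eq_bigr do rewrite /= (lmul_fun_seq _ _ (lsupp_uniq p)) // mulr_suml.
rewrite exchange_big mulr_suml /= big_seq [RHS]big_seq; apply: eq_bigr => w wp.
pose F w u := p w * q u * lmono_at z (u + w).
rewrite [LHS](_ : _ = \sum_(u <- lmul_supp p q) F w (u - w)); last first.
  by apply: eq_bigr => u _; rewrite /F subrK.
rewrite lmul_shift //; last first.
  by move=> u; rewrite mem_lsupp negbK /F => /eqP->; rewrite mulr0 mul0r.
rewrite mulr_sumr; apply: eq_bigr => u _.
by rewrite /F [u + w]addrC lmono_atD mulrACA.
Qed.

HB.instance Definition _ (z : torus) := GRing.isMonoidMorphism.Build
  (laurent C n) C (leval z) (leval_is_monoid_morphism z).

End Eval.

(** * The hypersurface ring and its modules *)

Section Hypersurface.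
Context (C : fieldType) (n : nat) (w : laurent C n) (z0 : torus C n).

Definition fiber_eqn : laurent C n := w - lconst n (leval z0 w).

Definition fiber_ideal : {pred laurent C n} :=
  fun p => `[< exists g, p = g * fiber_eqn >].

Lemma fiber_idealr : idealr_closed fiber_ideal.
Proof.
split=> [||a p q /asboolP[g ->] /asboolP[h ->]].
- by apply/asboolP; exists 0; rewrite mul0r.
- apply/asboolPn => -[g /(congr1 (leval z0))/eqP]; apply/negP.
  rewrite rmorphM rmorph1 rmorphB /= leval_term lmono_at0 mulr1 subrr mulr0.
  exact: oner_neq0.
- by apply/asboolP; exists (a * g + h); rewrite mulrDl mulrA.
Qed.

HB.instance Definition _ :=
  isIdealr.Build (laurent C n) fiber_ideal fiber_idealr.

(* R / (w - w(z0)) *)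
Definition fiber_ring := {ideal_quot fiber_ideal}.
HB.instance Definition _ := GRing.ComNzRing.on fiber_ring.

Definition to_fiber (p : laurent C n) : fiber_ring := \pi_(fiber_ring) p.

Lemma to_fiber_zmod : zmod_morphism to_fiber.
Proof. by move=> p q; rewrite /to_fiber !piE. Qed.
HB.instance Definition _ := GRing.isZmodMorphism.Build
  (laurent C n) fiber_ring to_fiber to_fiber_zmod.

Lemma to_fiber_monoid : monoid_morphism to_fiber.
Proof. by split=> [|p q]; rewrite /to_fiber !piE. Qed.
HB.instance Definition _ := GRing.isMonoidMorphism.Build
  (laurent C n) fiber_ring to_fiber to_fiber_monoid.

End Hypersurface.

Section QuotientModule.
Context (S : comNzRingType) (V : lmodType S) (P : {pred V}).
Hypothesis submodP : submod_closed P.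

Definition quot_pred of submod_closed P : {pred V} := P.
HB.instance Definition _ :=
  GRing.isZmodClosed.Build V (quot_pred submodP) (GRing.submod_closedB submodP).

Definition quotmod := Quotient.quot (quot_pred submodP).
HB.instance Definition _ := GRing.Zmodule.on quotmod.

Definition quotmod_pi (v : V) : quotmod := \pi_(Quotient.quot (quot_pred submodP)) v.

Definition quotmod_scale (a : S) (x : quotmod) : quotmod :=
  quotmod_pi (a *: repr x).

Lemma quotmod_piP u v : quotmod_pi u = quotmod_pi v <-> u - v \in P.
Proof.
rewrite -[P]/(quot_pred submodP : {pred V}) Quotient.idealrBE; by split=> [e|/eqP //]; exact/eqP.
Qed.

Lemma quotmod_piK x : quotmod_pi (repr x) = x.
Proof. exact: reprK. Qed.

Lemma quotmod_piD u v : quotmod_pi (u + v) = quotmod_pi u + quotmod_pi v.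
Proof. exact: raddfD. Qed.

Lemma quotmod_piZ a v : quotmod_pi (a *: v) = quotmod_scale a (quotmod_pi v).
Proof.
apply/quotmod_piP; rewrite -scalerBr; apply: (GRing.submod_closed_semi submodP).2.
by apply/quotmod_piP; rewrite quotmod_piK.
Qed.

Lemma quotmod_scaleA a b x :
  quotmod_scale a (quotmod_scale b x) = quotmod_scale (a * b) x.
Proof. by rewrite -(quotmod_piK x) -!quotmod_piZ scalerA. Qed.

Lemma quotmod_scale1 : left_id 1 quotmod_scale.
Proof. by move=> x; rewrite -(quotmod_piK x) -!quotmod_piZ scale1r. Qed.

Lemma quotmod_scaleDr : right_distributive quotmod_scale +%R.
Proof.
move=> a x y; rewrite -(quotmod_piK x) -(quotmod_piK y) -quotmod_piD.
by rewrite -!quotmod_piZ scalerDr quotmod_piD.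
Qed.

Lemma quotmod_scaleDl x :
  {morph quotmod_scale^~ x : a b / a + b >-> a + b}.
Proof.
move=> a b; rewrite -(quotmod_piK x) -!quotmod_piZ scalerDl.
by rewrite quotmod_piD.
Qed.

HB.instance Definition _ := GRing.Zmodule_isLmodule.Build S quotmod
  quotmod_scaleA quotmod_scale1 quotmod_scaleDr quotmod_scaleDl.

Lemma quotmod_pi_linear : linear quotmod_pi.
Proof. by move=> a u v; rewrite quotmod_piD quotmod_piZ. Qed.

HB.instance Definition _ :=
  GRing.isLinear.Build S V quotmod *:%R quotmod_pi quotmod_pi_linear.

End QuotientModule.

Definition fin_gen (S : comNzRingType) (M : lmodType S) : Prop :=
  exists n (g : 'I_n -> M), forall m, exists c : 'I_n -> S, m = \sum_(i < n) c i *: g i.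

Lemma fin_gen_quotmod (S : comNzRingType) (V : lmodType S) (P : {pred V})
    (hP : submod_closed P) :
  fin_gen V -> fin_gen (quotmod hP).
Proof.
move=> [n [g gP]]; exists n, (fun i => quotmod_pi hP (g i)) => x.
have [c e] := gP (repr x); exists c; rewrite -(quotmod_piK x) e.
by rewrite linear_sum; apply: eq_bigr => i _; rewrite linearZ.
Qed.

Lemma fin_gen_cV (S : comNzRingType) k : fin_gen 'cV[S]_k.
Proof.
exists k, (fun i => delta_mx i 0) => v; exists (fun i => v i 0).
by rewrite {1}[v]matrix_sum_delta; apply: eq_bigr => i _; rewrite big_ord1.
Qed.

Section Cokernel.
Context (S : comNzRingType) (k : nat) (A : 'M[S]_k).

Definition mx_image : {pred 'cV[S]_k} := fun v => `[< exists u, v = A *m u >].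

Lemma mx_image_submod : submod_closed mx_image.
Proof.
split=> [|a v v' /asboolP[u ->] /asboolP[u' ->]]; apply/asboolP.
  by exists 0; rewrite mulmx0.
by exists (a *: u + u'); rewrite mulmxDr scalemxAr.
Qed.

Definition coker := quotmod mx_image_submod.
HB.instance Definition _ := GRing.Lmodule.on coker.

Lemma fin_gen_coker : fin_gen coker.
Proof. exact/fin_gen_quotmod/fin_gen_cV. Qed.

End Cokernel.

Section Skyscraper.
Context (C : fieldType) (n : nat) (w : laurent C n) (z0 : torus C n).
Local Notation S := (fiber_ring w z0).

(* The image in S of the maximal ideal of z0. *)
Definition point_ideal : {pred S^o} :=
  fun s => `[< exists2 p, leval z0 p = 0 & s = to_fiber w z0 p >].

Lemma point_ideal_submod : submod_closed point_ideal.
Proof.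
split=> [|a s s' /asboolP[p p0 ->] /asboolP[p' p'0 ->]]; apply/asboolP.
  by exists 0; rewrite ?raddf0.
exists (repr a * p + p'); first by rewrite raddfD /= rmorphM /= p0 p'0 mulr0 addr0.
by rewrite /to_fiber -[a in LHS]reprK !piE.
Qed.

Definition skyscraper := quotmod point_ideal_submod.
HB.instance Definition _ := GRing.Lmodule.on skyscraper.

Lemma fin_gen_skyscraper : fin_gen skyscraper.
Proof.
apply: fin_gen_quotmod; exists 1, (fun=> 1) => m; exists (fun=> m).
by rewrite big_ord1 [_ *: _]mulr1.
Qed.

End Skyscraper.

(** * Bounded derived category and category of singularities *)

Record category := Category {
  ob :> Type;
  hom : ob -> ob -> Type;
  heq : forall A B, hom A B -> hom A B -> Prop;
  idm : forall A, hom A A;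
  comp : forall A B D, hom A B -> hom B D -> hom A D;
  heq_refl : forall A B (f : hom A B), heq f f;
  heq_sym : forall A B (f g : hom A B), heq f g -> heq g f;
  heq_trans : forall A B (f g h : hom A B), heq f g -> heq g h -> heq f h;
  heq_comp : forall A B D (f f' : hom A B) (g g' : hom B D),
    heq f f' -> heq g g' -> heq (comp f g) (comp f' g');
  comp1m : forall A B (f : hom A B), heq (comp (idm A) f) f;
  compm1 : forall A B (f : hom A B), heq (comp f (idm B)) f;
  compA : forall A B D E (f : hom A B) (g : hom B D) (h : hom D E),
    heq (comp f (comp g h)) (comp (comp f g) h) }.

Arguments idm {c}.

Definition is_iso (K : category) (A B : K) (f : hom A B) : Prop :=
  exists g : hom B A, heq (comp f g) (idm A) /\ heq (comp g f) (idm B).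

Definition isomorphic (K : category) (A B : K) : Prop :=
  exists f : hom A B, is_iso f.

(* The Gabriel-Zisman localization K[W^-1]: morphisms are formal composites of
   morphisms of K and of inverses of elements of W, modulo the congruence
   generated by the relations of K and w w^-1 = 1, w^-1 w = 1. *)
Section Localization.
Context (K : category) (W : forall A B : K, hom A B -> Prop).

Inductive loc_hom : K -> K -> Type :=
| LocId A : loc_hom A A
| LocComp A B D : loc_hom A B -> loc_hom B D -> loc_hom A D
| LocOf A B : hom A B -> loc_hom A B
| LocInv A B (w : hom A B) : W w -> loc_hom B A.

Inductive loc_eq : forall A B, loc_hom A B -> loc_hom A B -> Prop :=
| LocRefl A B (f : loc_hom A B) : loc_eq f f
| LocSym A B (f g : loc_hom A B) : loc_eq f g -> loc_eq g f
| LocTrans A B (f g h : loc_hom A B) : loc_eq f g -> loc_eq g h -> loc_eq f h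
| LocCongr A B D (f f' : loc_hom A B) (g g' : loc_hom B D) :
    loc_eq f f' -> loc_eq g g' -> loc_eq (LocComp f g) (LocComp f' g')
| Loc1m A B (f : loc_hom A B) : loc_eq (LocComp (LocId A) f) f
| Locm1 A B (f : loc_hom A B) : loc_eq (LocComp f (LocId B)) f
| LocAssoc A B D E (f : loc_hom A B) (g : loc_hom B D) (h : loc_hom D E) :
    loc_eq (LocComp f (LocComp g h)) (LocComp (LocComp f g) h)
| LocOfEq A B (f g : hom A B) : heq f g -> loc_eq (LocOf f) (LocOf g)
| LocOfId A : loc_eq (LocOf (idm A)) (LocId A)
| LocOfComp A B D (f : hom A B) (g : hom B D) :
    loc_eq (LocOf (comp f g)) (LocComp (LocOf f) (LocOf g))
| LocMulV A B (w : hom A B) (Ww : W w) :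
    loc_eq (LocComp (LocOf w) (LocInv Ww)) (LocId A)
| LocVMul A B (w : hom A B) (Ww : W w) :
    loc_eq (LocComp (LocInv Ww) (LocOf w)) (LocId B).

Definition localization : category :=
  @Category K loc_hom loc_eq LocId LocComp
    LocRefl LocSym LocTrans LocCongr Loc1m Locm1 LocAssoc.

End Localization.

Section Complexes.
Context (S : comNzRingType).

(* Bounded cochain complexes of finitely generated S-modules. *)
Record complexb := Complexb {
  cmod :> int -> lmodType S;
  cdiff : forall i, {linear cmod i -> cmod (i + 1)};
  cdiffK : forall i x, cdiff (i + 1) (cdiff i x) = 0;
  cfin_gen : forall i, fin_gen (cmod i);
  cbounded : exists N : nat, forall i : int, (N < `|i|)%N -> forall x : cmod i, x = 0 }.

Record chain_map (A B : complexb) := ChainMap {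
  cmap :> forall i, {linear A i -> B i};
  cmapd : forall i x, cmap (i + 1) (cdiff A i x) = cdiff B i (cmap i x) }.

Definition chain_eq A B (f g : chain_map A B) : Prop := forall i, f i =1 g i.

Definition chain_id A : chain_map A A :=
  @ChainMap A A (fun i => idfun) (fun i x => erefl).

Lemma chain_compd A B D (f : chain_map A B) (g : chain_map B D) i x :
  (g (i + 1) \o f (i + 1)) (cdiff A i x) = cdiff D i ((g i \o f i) x).
Proof. by rewrite /= !cmapd. Qed.

Definition chain_comp A B D (f : chain_map A B) (g : chain_map B D) :
  chain_map A D := @ChainMap A D (fun i => g i \o f i) (chain_compd f g).

Lemma chain_eq_sym A B (f g : chain_map A B) : chain_eq f g -> chain_eq g f.
Proof. by move=> fg i x; rewrite (fg i x). Qed.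

Lemma chain_eq_trans A B (f g h : chain_map A B) :
  chain_eq f g -> chain_eq g h -> chain_eq f h.
Proof. by move=> fg gh i x; rewrite (fg i x) (gh i x). Qed.

Lemma chain_eq_comp A B D (f f' : chain_map A B) (g g' : chain_map B D) :
  chain_eq f f' -> chain_eq g g' -> chain_eq (chain_comp f g) (chain_comp f' g').
Proof. by move=> ff' gg' i x; rewrite /= (ff' i x) (gg' i _). Qed.

Definition complexb_cat : category :=
  @Category complexb chain_map chain_eq chain_id chain_comp
    (fun _ _ _ _ _ => erefl) chain_eq_sym chain_eq_trans chain_eq_comp
    (fun _ _ _ _ _ => erefl) (fun _ _ _ _ _ => erefl)
    (fun _ _ _ _ _ _ _ _ _ => erefl).

(* f is bijective on cohomology. *)
Definition quasi_iso (A B : complexb) (f : chain_map A B) : Prop :=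
  forall i : int,
  (forall b : B (i + 1), cdiff B _ b = 0 ->
     exists a : A (i + 1), cdiff A _ a = 0 /\
       exists b' : B i, b = f _ a + cdiff B _ b') /\
  (forall a : A (i + 1), cdiff A _ a = 0 ->
     (exists b' : B i, f _ a = cdiff B _ b') -> exists a' : A i, a = cdiff A _ a').

(* D^b(mod S) *)
Definition derived_cat : category := @localization complexb_cat quasi_iso.

Definition derived_map (A B : complexb) (f : chain_map A B) :
  @hom derived_cat A B := @LocOf complexb_cat quasi_iso A B f.

Section Cone.
Context (A B : complexb) (f : chain_map A B).

Definition cone_mod (i : int) : lmodType S := (A (i + 1)%R * B i)%type.

Definition cone_diff_fun i (x : cone_mod i) : cone_mod (i + 1) :=
  (- cdiff A _ x.1, f _ x.1 + cdiff B _ x.2).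

Lemma cone_diff_linear i : linear (@cone_diff_fun i).
Proof.
move=> a x y; rewrite /cone_diff_fun /=; congr pair; rewrite /= !linearP //.
by rewrite scalerDr addrACA.
Qed.

HB.instance Definition _ i := GRing.isLinear.Build S (cone_mod i)
  (cone_mod (i + 1)) *:%R (@cone_diff_fun i) (@cone_diff_linear i).

Lemma cone_diffK (i : int) x : @cone_diff_fun (i + 1) (@cone_diff_fun i x) = 0.
Proof.
rewrite /cone_diff_fun /= !raddfN /= cdiffK !oppr0 raddfD /= cdiffK addr0.
by rewrite cmapd addNr.
Qed.

Lemma cone_fin_gen i : fin_gen (cone_mod i).
Proof.
have [m [g gP]] := cfin_gen A (i + 1); have [k [h hP]] := cfin_gen B i.
pose e (j : 'I_(m + k)) : cone_mod i :=
  match fintype.split j with inl a => (g a, 0) | inr b => (0, h b) end.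
exists (m + k)%N, e => -[x y]; have [c ->] := gP x; have [d ->] := hP y.
exists (fun j => match fintype.split j with inl a => c a | inr b => d b end).
rewrite big_split_ord /= /e.
have sl j : fintype.split (lshift k j) = inl j := unsplitK (inl j).
have sr j : fintype.split (rshift m j) = inr j := unsplitK (inr j).
under [X in _ = X + _]eq_bigr do rewrite sl.
under [X in _ = _ + X]eq_bigr do rewrite sr.
rewrite [RHS]surjective_pairing; congr pair.
  rewrite raddfD /= !raddf_sum /= [X in _ = _ + X]big1 ?addr0 // => j _.
  exact: scaler0.
rewrite raddfD /= !raddf_sum /= [X in _ = X + _]big1 ?add0r // => j _.
exact: scaler0.
Qed.

Lemma cone_bounded : exists N : nat, forall i : int, (N < `|i|)%N ->
  forall x : cone_mod i, x = 0.
Proof.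
have [N NP] := cbounded A; have [M MP] := cbounded B.
exists (N + M).+1 => i iN [x y]; congr pair; [apply: NP|apply: MP]; lia.
Qed.

Definition cone : complexb :=
  @Complexb cone_mod (fun i => @cone_diff_fun i) cone_diffK cone_fin_gen cone_bounded.

End Cone.

Definition in_degree0 (M : lmodType S) (i : int) : lmodType S :=
  if i is Posz 0 then M else 'rV[S]_0.

Lemma in_degree0_fin_gen M i : fin_gen M -> fin_gen (in_degree0 M i).
Proof.
have z : fin_gen 'rV[S]_0.
  by exists 0, (fun=> 0) => v; exists (fun=> 0); rewrite big_ord0 [v]thinmx0.
by case: i => [[|?]|?].
Qed.

Lemma in_degree0_bounded M : exists N : nat, forall i : int, (N < `|i|)%N ->
  forall x : in_degree0 M i, x = 0.
Proof. by exists 0 => -[[|k]|k] //= _ x; exact: thinmx0. Qed.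

(* The module M as a complex concentrated in degree 0. *)
Definition stalk (M : lmodType S) (fgM : fin_gen M) : complexb :=
  @Complexb (in_degree0 M) (fun i => \0) (fun i x => erefl)
    (fun i => in_degree0_fin_gen i fgM) (in_degree0_bounded M).

Definition projective (P : lmodType S) : Prop :=
  forall (M N : lmodType S) (g : {linear M -> N}) (f : {linear P -> N}),
    (forall y, exists x, g x = y) -> exists h : {linear P -> M}, forall x, g (h x) = f x.

(* Perfect complexes: objects of D^b isomorphic to bounded complexes of
   finitely generated projectives. *)
Definition perfect (A : derived_cat) : Prop :=
  exists P : complexb, (forall i, projective (P i)) /\ isomorphic A (P : derived_cat).

(* A morphism of D^b whose cone is perfect: the distinguished triangles of D^b
   are those isomorphic to the triangles of mapping cones of chain maps. *)
Definition perfect_cone (A B : derived_cat) (phi : hom A B) : Prop :=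
  exists (A' B' : complexb) (f : chain_map A' B')
    (alpha : hom A (A' : derived_cat)) (beta : hom B (B' : derived_cat)),
    [/\ is_iso alpha, is_iso beta,
      heq (comp phi beta) (comp alpha (derived_map f))
      & perfect (cone f : derived_cat)].

(* The Verdier quotient D^b(mod S) / Perf. *)
Definition singularity_cat : category := @localization derived_cat perfect_cone.

End Complexes.

(** * Matrix factorizations and points *)

Section MatrixFactorization.
Context (C : fieldType) (n k : nat) (w : laurent C n).

Definition matrix_factorization (lambda : C) (M : 'M[laurent C n]_(k + k)) : Prop :=
  [/\ ulsubmx M = 0, drsubmx M = 0 & M *m M = (w - lconst n lambda)%:M].

(* M corresponds under Orlov's equivalence to the structure sheaf of z0: with
   F the upper right block of M, Coker(F) and R/m_{z0} are isomorphic in the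
   category of singularities of R/(w - w(z0)). *)
Definition corresponds_to_point (M : 'M[laurent C n]_(k + k)) (z0 : torus C n) : Prop :=
  matrix_factorization (leval z0 w) M /\
  @isomorphic (singularity_cat (fiber_ring w z0))
    (stalk (fin_gen_coker (map_mx (to_fiber w z0) (ursubmx M))))
    (stalk (fin_gen_skyscraper w z0)).

End MatrixFactorization.

(** * SYZ mirror symmetry for projective spaces *)

Section RowVectors.
Context (T : Type).
Definition rv1 (a : T) : 'rV[T]_1 := \row_j a.
Definition rv2 (a b : T) : 'rV[T]_2 := \row_j (if j == 0 then a else b).
End RowVectors.

Definition mx_of_rows (T : nmodType) m n (s : seq (seq T)) : 'M[T]_(m, n) :=
  \matrix_(i, j) (nth [::] s i)`_j.

Section SYZ.
Context (R : realType).
Local Notation C := R[i].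

(* Moment polytope of P^n. *)
Definition polytope n (t : R) : set 'rV[R]_n :=
  [set x | (forall j, 0 <= x 0 j) /\ \sum_j x 0 j <= t].

Definition center_of_mass1 (P : set 'rV[R]_1) : 'rV[R]_1 :=
  let mu := @lebesgue_measure R in
  let D := [set s | P (rv1 s)] in
  rv1 ((\int[mu]_(s in D) s) / fine (mu D)).

Definition center_of_mass2 (P : set 'rV[R]_2) : 'rV[R]_2 :=
  let mu := (@lebesgue_measure R \x @lebesgue_measure R)%E in
  let D := [set s : R * R | P (rv2 s.1 s.2)] in
  rv2 ((\int[mu]_(s in D) s.1) / fine (mu D))
      ((\int[mu]_(s in D) s.2) / fine (mu D)).

Definition expi (a : R) : C := cos a +i* sin a.

Lemma expi_neq0 a : expi a != 0.
Proof.
apply/eqP => -[c0 s0]; have := cos2Dsin2 a.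
by rewrite c0 s0 expr0n addr0 => /eqP; rewrite eq_sym oner_eq0.
Qed.

Definition syz_coord n (x y : 'rV[R]_n) : 'rV[C]_n :=
  \row_j ((expR (- x 0 j))%:C * expi (y 0 j)).

Lemma syz_coord_neq0 n (x y : 'rV[R]_n) : [forall j, syz_coord x y 0 j != 0].
Proof.
apply/forallP => j; rewrite mxE mulf_neq0 ?expi_neq0 //.
by rewrite eq_complex /= gt_eqF ?expR_gt0.
Qed.

(* The mirror point of (L_x, nabla_y); y is a representative of a class in
   (R / 2 pi Z)^n. *)
Definition syz_point n (x y : 'rV[R]_n) : torus C n := Torus (syz_coord_neq0 x y).

Definition mirror_domain n (q : R) : set (torus C n) :=
  [set z | (forall j, `|z 0 j| < 1) /\ q%:C < `|\prod_j z 0 j|].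

Definition potential n (q : R) : laurent C n :=
  \sum_j lvar C j + lterm q%:C (const_mx (- 1)).

Definition pairing n (v : 'rV[int]_n) (y : 'rV[R]_n) : R :=
  \sum_j (v 0 j)%:~R * y 0 j.

Definition syz_transform n k (Psi : 'rV[R]_n -> 'rV[int]_n -> 'M[C]_k)
    (x y : 'rV[R]_n) : 'M[C]_k :=
  \sum_(v \in [set: 'rV[int]_n]) expi (pairing v y) *: Psi x v.

(* The A-brane (L_x, nabla_y), for x in the interior of the moment polytope, is
   mirror to M. *)
Definition mirror_to_brane n k (t : R) (M : 'M[laurent C n]_(k + k))
    (x y : 'rV[R]_n) : Prop :=
  [/\ interior (polytope t) x, mirror_domain (expR (- t)) (syz_point x y)
    & corresponds_to_point (potential n (expR (- t))) M (syz_point x y)].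

(** ** The deformed Lagrangian for P^1 *)

(* The sheet + is true and the sheet - is false. *)
Record disk := Disk {
  disk_from : bool; disk_to : bool; disk_class : int; disk_sign : int; disk_area : R }.

(* The holomorphic disks with boundary on L and L_x, for 0 < x < t/2. *)
Definition disksP1 (t x : R) : seq disk :=
  [:: Disk true false 1 1 x; Disk true false 0 (-1) (t / 2);
      Disk false true 0 1 0; Disk false true (-1) (-1) (t / 2 - x)].

Definition psiP1 (t : R) (a b : bool) (x : 'rV[R]_1) (v : 'rV[int]_1) : R :=
  \sum_(d <- disksP1 t (x 0 0) |
        [&& disk_from d == a, disk_to d == b & disk_class d == v 0 0])
    (disk_sign d)%:~R * expR (- disk_area d).

Lemma psiP1E t a b x v : psiP1 t a b x v =
  let q := expR (- t) in
  match a, b with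
  | true, false => if v == rv1 1 then expR (- x 0 0)
                   else if v == rv1 0 then - Num.sqrt q else 0
  | false, true => if v == rv1 0 then 1
                   else if v == rv1 (-1) then - (Num.sqrt q / expR (- x 0 0)) else 0
  | _, _ => 0
  end.
Proof.
have sq : Num.sqrt (expR (- t)) = expR (- (t / 2)).
  rewrite (_ : - t = - (t / 2) + - (t / 2)); last by rewrite -opprD -splitr.
  by rewrite expRD -expr2 sqrtr_sqr ger0_norm ?expR_ge0.
have ve u : (v == rv1 u) = (u == v 0 0).
  apply/eqP/eqP => [->|uv]; first by rewrite mxE.
  by apply/rowP => j; rewrite ord1 mxE.
rewrite /psiP1 unlock /= !ve sq.
case: a; case: b => //=; rewrite !mul1r ?mulN1r ?oppr0 ?expR0 ?opprB.
  by have [<-|_] := eqVneq 1 (v 0 0); rewrite !addr0.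
have [<-|_] := eqVneq 0 (v 0 0); first by rewrite addr0.
have [_|//] := eqVneq (-1) (v 0 0).
by rewrite addr0 -expRN opprK -expRD addrC.
Qed.

Definition PsiP1 (t : R) (x : 'rV[R]_1) (v : 'rV[int]_1) : 'M[C]_(1 + 1) :=
  let psi a b := (psiP1 t a b x v)%:C in
  mx_of_rows _ _
    [:: [:: 0;              psi true false];
        [:: psi false true; 0]].

Definition regionP1 (t : R) : set 'rV[R]_1 := [set x | 0 < x 0 0 < t / 2].

(** ** The deformed Lagrangian for P^2 *)

Definition psiP2 (t : R) (a b : bool * bool) (x : 'rV[R]_2) (v : 'rV[int]_2) : R :=
  let q1 := expR (- t) `^ (1 / 3) in
  let q2 := expR (- t) `^ (2 / 3) in
  let e1 := expR (- x 0 0) in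
  let e2 := expR (- x 0 1) in
  let vals v1 c1 v2 c2 : R := if v == v1 then c1 else if v == v2 then c2 else 0 in
  let pp := (true, true) in let mp := (false, true) in
  let pm := (true, false) in let mm := (false, false) in
  if (a, b) \in [:: (pp, mp); (pm, mm)] then vals (rv2 1 0) e1 (rv2 0 0) (- q1)
  else if (a, b) == (pp, pm) then vals (rv2 0 1) e2 (rv2 (-1) 0) (- (q2 / e1))
  else if (a, b) == (mp, mm) then vals (rv2 0 1) (- e2) (rv2 (-1) 0) (q2 / e1)
  else if (a, b) == (mm, mp) then vals (rv2 0 0) (- 1) (rv2 0 (-1)) (q1 / e2)
  else if (a, b) == (pm, pp) then vals (rv2 0 0) 1 (rv2 0 (-1)) (- (q1 / e2))
  else if (a, b) \in [:: (mm, pm); (mp, pp)] then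
    vals (rv2 0 0) 1 (rv2 (-1) 0) (- (q1 / e1))
  else 0.

Definition PsiP2 (t : R) (x : 'rV[R]_2) (v : 'rV[int]_2) : 'M[C]_(2 + 2) :=
  let psi a b := (psiP2 t a b x v)%:C in
  let pp := (true, true) in let mp := (false, true) in
  let pm := (true, false) in let mm := (false, false) in
  mx_of_rows _ _
    [:: [:: 0;         0;         psi pp mp; psi pp pm];
        [:: 0;         0;         psi mm mp; psi mm pm];
        [:: psi mp pp; psi mp mm; 0;         0        ];
        [:: psi pm pp; psi pm mm; 0;         0        ]].

Definition regionP2 (t : R) : set 'rV[R]_2 :=
  [set x | 0 < x 0 0 < t / 3 /\ 0 < x 0 1 < t / 3].

(** ** The matrix factorizations *)

Definition M0_P1 (q : R) : 'M[laurent C 1]_(1 + 1) :=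
  let z := lvar C (0 : 'I_1) in
  let zV := lvarV C (0 : 'I_1) in
  let r := lconst 1 (Num.sqrt q)%:C in
  mx_of_rows _ _
    [:: [:: 0;          z - r];
        [:: 1 - r * zV; 0    ]].

Definition M0_P2 (q : R) : 'M[laurent C 2]_(2 + 2) :=
  let z1 := lvar C (0 : 'I_2) in let z1V := lvarV C (0 : 'I_2) in
  let z2 := lvar C (1 : 'I_2) in let z2V := lvarV C (1 : 'I_2) in
  let q1 := lconst 2 (q `^ (1 / 3))%:C in
  let q2 := lconst 2 (q `^ (2 / 3))%:C in
  mx_of_rows _ _
    [:: [:: 0;            0;                 z1 - q1;          z2 - q2 * z1V];
        [:: 0;            0;                 - (1 - q1 * z2V); 1 - q1 * z1V ];
        [:: 1 - q1 * z1V; - (z2 - q2 * z1V); 0;                0            ];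
        [:: 1 - q1 * z2V; z1 - q1;           0;                0            ]].

End SYZ.

Arguments polytope {R} n t.

(* Main.v *)
Require Import Defs.
From HB Require Import structures.
From mathcomp Require Import all_boot all_order all_algebra complex.
From mathcomp Require Import generic_quotient ring_quotient.
From mathcomp Require Import all_classical all_reals all_analysis.
From mathcomp Require Import measurable_realfun ring lra zify.
Import Order.TTheory GRing.Theory Num.Theory.
Import numFieldNormedType.Exports.
Local Open Scope classical_set_scope.
Local Open Scope ring_scope.
Local Open Scope complex_scope.
Set Implicit Arguments.
Unset Strict Implicit.
Unset Printing Implicit Defensive.

(* The point of interest is the isomorphism in the category of singularities.
   Write S = R/(W - W(z0)). For P^1 the block F is z - z0, whose cokernel over S
   is already the skyscraper module. For P^2, with generators e1, e2 of Coker(F),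
   sending e1 to 0 and e2 to 1 defines a surjection onto R/m_{z0}, since the
   second row of F generates m_{z0}. Its kernel is S e1, which is free: if a e1
   lies in the image of F, multiplying by the adjugate G shows that W - W(z0)
   divides (z1 - c) a, and W - W(z0) is coprime to z1 - c because it equals
   (z2 - c)^2 / z2 modulo z1 - c. So Coker(F) and R/m_{z0} differ by a perfect
   complex. *)

(** * Isomorphisms in localized categories, and the zero module *)

Lemma isomorphic_sym (K : category) (A B : K) :
  isomorphic A B -> isomorphic B A.
Proof. by move=> [f [g [fg gf]]]; exists g, f. Qed.

(** Serves at two levels: for quasi-isomorphisms in the derived category and for maps with perfect
    cone in the category of singularities. *)
Lemma localization_iso (K : category) (W : forall A B : K, Defs.hom A B -> Prop)
    (A B : K) (f : Defs.hom A B) :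
  W A B f -> @isomorphic (localization W) A B.
Proof.
move=> Wf; exists (LocOf W f), (LocInv Wf).
by split; [exact: LocMulV|exact: LocVMul].
Qed.

Lemma is_iso_id (K : category) (A : K) : is_iso (idm A).
Proof. by exists (idm A); split; exact: comp1m. Qed.

Lemma rV0_projective (S : comNzRingType) : projective 'rV[S]_0.
Proof. by move=> U V h k _; exists \0 => x; rewrite [x]thinmx0 !raddf0. Qed.

Lemma rV0_fin_gen (S : comNzRingType) : fin_gen 'rV[S]_0.
Proof.
by exists 0%N, (fun=> 0) => v; exists (fun=> 0); rewrite big_ord0 [v]thinmx0.
Qed.

(** * Quotients by projective submodules in the category of singularities *)

Section ShortExactSequence.
Context (S : comNzRingType) (P M N : lmodType S).
Context (g : {linear P -> M}) (f : {linear M -> N}).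
Hypotheses (fgP : fin_gen P) (fgM : fin_gen M) (fgN : fin_gen N).

(** The match repeats the one in [in_degree0], so that source and target reduce in each branch. *)
Definition degree0_map (U V : lmodType S) (h : {linear U -> V}) (i : int) :
    {linear in_degree0 U i -> in_degree0 V i} :=
  match i return {linear in_degree0 U i -> in_degree0 V i} with
  | Posz 0 => h
  | _ => \0
  end.

Definition stalk_map (U V : lmodType S) (fgU : fin_gen U) (fgV : fin_gen V)
    (h : {linear U -> V}) : chain_map (stalk fgU) (stalk fgV) :=
  @ChainMap S (stalk fgU) (stalk fgV) (degree0_map h)
    (fun i x => raddf0 (degree0_map h (i + 1))).

Lemma degree0_trivial (i : int) (x : in_degree0 P i) : i != 0 -> x = 0.
Proof. by case: i x => [[|k]|k] //= x _; exact: thinmx0. Qed.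

Lemma shifted_bounded : exists b : nat, forall i : int, (b < `|i|)%N ->
  forall x : in_degree0 P (i + 1), x = 0.
Proof. by exists 1%N => i i1 x; apply: degree0_trivial; lia. Qed.

(** Degree i is indexed by i + 1 exactly as the first component of a cone is, so the map into the
    cone needs no transport between degrees. *)
Definition shifted_stalk : complexb S :=
  @Complexb S (fun i => in_degree0 P (i + 1)) (fun i => \0) (fun i x => erefl)
    (fun i => in_degree0_fin_gen (i + 1) fgP) shifted_bounded.

Lemma degree0_projective i : projective P -> projective (in_degree0 P i).
Proof.
by move=> pP; case: i => [[|k]|k] //=; exact: rV0_projective.
Qed.

Hypotheses (g_inj : injective g) (f_surj : forall y, exists x, f x = y).
Hypothesis (fg_exact : forall x, f x = 0 <-> exists y, x = g y).

Lemma degree0_inj i (x : in_degree0 P i) : degree0_map g i x = 0 -> x = 0.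
Proof.
case: i x => [[|k]|k] //= x; [|by rewrite [x]thinmx0..].
by move=> gx; apply: g_inj; rewrite gx raddf0.
Qed.

Lemma degree0_surj i (y : in_degree0 N i) : exists x, degree0_map f i x = y.
Proof.
case: i y => [[|k]|k] /= y; [by have [x] := f_surj y; exists x|..];
  by exists 0; rewrite [y]thinmx0.
Qed.

Lemma degree0_exact i (x : in_degree0 M i) :
  degree0_map f i x = 0 -> exists y, x = degree0_map g i y.
Proof.
case: i x => [[|k]|k] /= x; [by move/fg_exact=> [y]; exists y|..];
  by exists 0; rewrite [x]thinmx0.
Qed.

Lemma degree0_comp i (y : in_degree0 P i) :
  degree0_map f i (degree0_map g i y) = 0.
Proof. by case: i y => [[|k]|k] //= y; apply/fg_exact; exists y. Qed.

(* The kernel P, placed in degree -1, maps quasi-isomorphically to the cone of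
   M -> N, so this cone is perfect. *)
Let Cf : complexb S := cone (stalk_map fgM fgN f).

Definition to_cone_fun i (x : shifted_stalk i) : Cf i :=
  (degree0_map g (i + 1) x, 0).

Lemma to_cone_linear i : linear (@to_cone_fun i).
Proof.
move=> a x y; rewrite /to_cone_fun linearP.
by congr pair; rewrite /= scaler0 addr0.
Qed.

HB.instance Definition _ i := GRing.isLinear.Build S (shifted_stalk i) (Cf i)
  *:%R (@to_cone_fun i) (@to_cone_linear i).

Lemma to_coned i x :
  @to_cone_fun (i + 1) (cdiff shifted_stalk i x) = cdiff Cf i (to_cone_fun x).
Proof.
rewrite /to_cone_fun /= raddf0 /cone_diff_fun /=.
by congr pair; rewrite ?oppr0 // degree0_comp addr0.
Qed.

Definition to_cone : chain_map shifted_stalk Cf :=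
  @ChainMap S shifted_stalk Cf (fun i => @to_cone_fun i) to_coned.

(** All stalk differentials vanish, so the cone differential is (m, n) -> (0, f m). A cocycle has f
    m = 0, hence m = g a by exactness, and n is a coboundary by surjectivity of f. A coboundary has
    first component 0, so injectivity of g gives injectivity on cohomology. *)
Lemma to_cone_quasi_iso : quasi_iso to_cone.
Proof.
move=> i; split=> [[m n] [_ fm]|a _ [[m n] [gm _]]].
  have [a ->] : exists a, m = degree0_map g (i + 1 + 1) a.
    by apply: degree0_exact; rewrite -[LHS]addr0; exact: fm.
  have [m' <-] := degree0_surj n.
  (* The differential of (m', 0) is (0, f m') = (0, n). *)
  exists a; split=> //; exists (m', 0); congr pair.
    by rewrite /= oppr0 addr0.
  by rewrite /= addr0 add0r.
exists 0; apply: degree0_inj; rewrite gm; exact: oppr0.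
Qed.

(** The stalk map of f is itself one of the inverted morphisms: its own cone serves as the triangle,
    with identities for [alpha] and [beta], and [to_cone] identifies that cone with a complex of
    projectives. *)
Lemma singularity_iso : projective P ->
  @isomorphic (singularity_cat S) (stalk fgM) (stalk fgN).
Proof.
move=> pP; apply: (localization_iso (f := derived_map (stalk_map fgM fgN f))).
exists (stalk fgM), (stalk fgN), (stalk_map fgM fgN f), (idm _), (idm _); split.
- exact: is_iso_id.
- exact: is_iso_id.
- exact: heq_trans (compm1 _) (heq_sym (comp1m _)).
- exists shifted_stalk; split; first by move=> i; exact: degree0_projective.
  exact/isomorphic_sym/localization_iso/to_cone_quasi_iso.
Qed.

End ShortExactSequence.

(** * The free module of rank one, and linear maps out of quotient modules *)

Lemma regular_projective (S : comNzRingType) : projective S^o.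
Proof.
move=> M N g f g_surj; have [x gx] := g_surj (f 1).
have lin : linear (fun a : S^o => a *: x) by move=> a b c; rewrite scalerDl scalerA.
pose h := HB.pack_for {linear S^o -> M} (fun a : S^o => a *: x)
  (GRing.isLinear.Build S S^o M *:%R _ lin).
by exists h => a; rewrite /h /= linearZ /= gx -linearZ /= [_ *: _]mulr1.
Qed.

Lemma regular_fin_gen (S : comNzRingType) : fin_gen S^o.
Proof.
by exists 1%N, (fun=> 1) => m; exists (fun=> m); rewrite big_ord1 [_ *: _]mulr1.
Qed.

Section QuotientLift.
Context (S : comNzRingType) (V W : lmodType S) (P : {pred V}).
Context (submodP : submod_closed P) (f : {linear V -> W}).

(** The vanishing of f on P is carried in the term so that the linear structure declared below can
    be inferred from it. *)
Definition quotmod_lift of (forall v, v \in P -> f v = 0) :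
  quotmod submodP -> W := fun x => f (repr x).

Hypothesis f0 : forall v, v \in P -> f v = 0.

Lemma quotmod_liftE v : quotmod_lift f0 (quotmod_pi submodP v) = f v.
Proof.
apply/eqP; rewrite -subr_eq0 -raddfB; apply/eqP/f0/(quotmod_piP submodP).
exact: quotmod_piK.
Qed.

Lemma quotmod_lift_linear : linear (quotmod_lift f0).
Proof.
move=> a x y; rewrite -(quotmod_piK x) -(quotmod_piK y) -linearP.
by rewrite !quotmod_liftE linearP.
Qed.

HB.instance Definition _ := GRing.isLinear.Build S (quotmod submodP) W *:%R
  (quotmod_lift f0) quotmod_lift_linear.

End QuotientLift.

(** * Laurent polynomials *)

Section LaurentRing.
Context (C : fieldType) (n : nat).
Implicit Types (p q h r : laurent C n) (u v w : 'rV[int]_n) (c d x y : C).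

Lemma mul_lterm_coef c u p v : (lterm c u * p) v = c * p (v - u).
Proof.
rewrite [LHS](lmul_fun_seq p v (s := [:: u])) // ?big_seq1 /= ?eqxx //.
exact: lsupp_term.
Qed.

Lemma mul_lterm c d u v : lterm c u * lterm d v = lterm (c * d) (u + v).
Proof.
apply/laurentP => w; rewrite mul_lterm_coef /= subr_eq addrC.
by case: eqP; rewrite ?mulr0.
Qed.

Lemma add_lterm c d v : lterm c v + lterm d v = lterm (c + d) v.
Proof. by apply/laurentP => w; rewrite lcoefD /= -mulrnDl. Qed.

Lemma lvarK (j : 'I_n) : lvar C j * lvarV C j = 1.
Proof. by rewrite mul_lterm mulr1 subrr. Qed.

Lemma leval_lconst (z : 'rV[C]_n) c : leval z (lconst n c) = c.
Proof. by rewrite leval_term lmono_at0 mulr1. Qed.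

Lemma lmono_at_delta (z : 'rV[C]_n) (j : 'I_n) (m : int) :
  lmono_at z (delta_mx 0 j *~ m) = z 0 j ^ m.
Proof.
rewrite /lmono_at (bigD1 j) //= big1 ?mulr1 => [|i /negPf ij]; rewrite -scaler_int !mxE.
  by rewrite !eqxx mulr1 intz.
by rewrite ij andbF mulr0 expr0z.
Qed.

Lemma leval_lvar (z : 'rV[C]_n) (j : 'I_n) : leval z (lvar C j) = z 0 j.
Proof. by rewrite leval_term mul1r -[delta_mx _ _]mulr1z lmono_at_delta. Qed.

Lemma leval_lvarV (z : 'rV[C]_n) (j : 'I_n) : leval z (lvarV C j) = (z 0 j)^-1.
Proof.
rewrite leval_term mul1r (_ : - _ = delta_mx 0 j *~ -1) ?lmono_at_delta //.
Qed.

Lemma laurent_sum p : p = \sum_(v <- lsupp p) lterm (p v) v.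
Proof.
apply/laurentP => w.
rewrite (big_morph (fun q : laurent C n => q w) (id1 := 0) (op1 := +%R)) //.
have [wp|wp] := boolP (w \in lsupp p).
  rewrite (bigD1_seq w) ?lsupp_uniq //= eqxx big1 ?addr0 // => v /negPf.
  by rewrite eq_sym => ->.
rewrite big_seq big1 => [|v vp]; first by move: wp; rewrite mem_lsupp negbK => /eqP.
by rewrite /=; case: eqP => // wv; rewrite -wv (negPf wp) in vp.
Qed.

Lemma lvar_sub_coef j c p v :
  ((lvar C j - lconst n c) * p) v = p (v - delta_mx 0 j) - c * p v.
Proof. by rewrite mulrBl lcoefD lcoefN !mul_lterm_coef mul1r subr0. Qed.

(* A geometric progression of coefficients along a ray contradicts finiteness
   of the support. *)
Lemma geometric_ray_eq0 p v u c : u != 0 -> c != 0 ->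
  (forall k, p (v + u *+ k.+1) = c * p (v + u *+ k)) -> p v = 0.
Proof.
move=> u0 c0 step; apply: contraTeq isT => pv0.
have nz k : p (v + u *+ k) != 0.
  by elim: k => [|k IH]; rewrite ?addr0 // step mulf_neq0.
have [j uj] : exists j, u 0 j != 0 by move/rV0Pn: u0.
(* One more exponent on the ray than the support contains; they are distinct because the coordinate
   u_j is nonzero. *)
pose s := [seq v + u *+ k | k <- iota 0 (size (lsupp p)).+1].
have us : uniq s.
  rewrite map_inj_uniq ?iota_uniq // => a b /addrI /rowP /(_ j).
  by rewrite !mulmxnE => /(mulrIn uj).
have : (size s <= size (lsupp p))%N.
  by apply: uniq_leq_size => // w /mapP[k _ ->]; rewrite mem_lsupp.
by rewrite size_map size_iota ltnn.
Qed.

Lemma delta_neq0 (j : 'I_n) : delta_mx 0 j != 0 :> 'rV[int]_n.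
Proof. by apply/rV0Pn; exists j; rewrite mxE !eqxx. Qed.

(** Comparing coefficients gives p(v - e_j) = c p(v), a geometric progression in the direction
    -e_j. *)
Lemma lvar_sub_regular j c p : c != 0 ->
  (lvar C j - lconst n c) * p = 0 -> p = 0.
Proof.
move=> c0 /laurentP e; apply/laurentP => v; rewrite lcoef0.
apply: (@geometric_ray_eq0 _ _ (- delta_mx 0 j) c) => // [|k].
  by rewrite oppr_eq0 delta_neq0.
have := e (v + (- delta_mx 0 j) *+ k); rewrite lvar_sub_coef lcoef0 => /eqP.
by rewrite subr_eq0 mulrSr addrA => /eqP.
Qed.

(** Modulo z_j - c the variable z_j equals the unit c, so a power z_j^m of either sign can be traded
    for c^m. The induction keeps x general because each step absorbs a factor c or 1/c into it. *)
Lemma lterm_reduction j c x v (m : int) : c != 0 -> exists a y,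
  lterm x (v + delta_mx 0 j *~ m) = (lvar C j - lconst n c) * a + lterm y v.
Proof.
move=> c0; elim/int_ind: m x => [x|m IH x|m IH x].
- by exists 0, x; rewrite mulr0z addr0 mulr0 add0r.
- have [a [y e]] := IH (c * x).
  exists (lterm x (v + delta_mx 0 j *~ m) + a), y.
  rewrite mulrDr -addrA -e mulrBl !mul_lterm mul1r add0r subrK.
  by rewrite addrCA intS mulrzDr mulr1z.
- have [a [y e]] := IH (c^-1 * x).
  exists (a - lterm (c^-1 * x) (v - delta_mx 0 j *~ m.+1)), y.
  rewrite mulrBr addrAC -e mulrBl !mul_lterm mul1r add0r mulVKf //.
  rewrite !mulrNz [delta_mx 0 j + _](_ : _ = v - delta_mx 0 j *~ m) ?subKr //.
  by rewrite intS mulrzDr mulr1z opprD addrCA addNKr.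
Qed.

Lemma laurent_reduction j c p : c != 0 -> exists a r,
  p = (lvar C j - lconst n c) * a + r /\ forall v, v 0 j != 0 -> r v = 0.
Proof.
move=> c0; rewrite [p]laurent_sum.
elim/big_ind: _ => [|p1 p2 [a1 [r1 [-> s1]]] [a2 [r2 [-> s2]]]|v _].
- by exists 0, 0; rewrite mulr0 addr0.
- exists (a1 + a2), (r1 + r2); rewrite mulrDr addrACA; split=> // v vj.
  by rewrite lcoefD s1 // s2 // addr0.
(* The exponent v with its j-th entry set to 0. *)
- pose w := v - delta_mx 0 j *~ v 0 j.
  have [a [y e]] := lterm_reduction j (p v) w (v 0 j) c0.
  exists a, (lterm y w); split; first by rewrite -e subrK.
  move=> u uj /=; case: eqP => // uw; move: uj; rewrite uw /w -scaler_int.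
  by rewrite !mxE !eqxx mulr1 intz subrr eqxx.
Qed.

(* Writing p = (z_i - c) a + r with r free of z_i, the equation leaves a quotient
   whose coefficients are geometric along the z_i-axis away from v_i = 0. *)
Lemma lvar_sub_regular_mod i j c d p h : i != j -> c != 0 -> d != 0 ->
  (lvar C j - lconst n d) * p = (lvar C i - lconst n c) * h ->
  exists a, p = (lvar C i - lconst n c) * a.
Proof.
move=> ij c0 d0 e; have [a [r [pE rs]]] := laurent_reduction i p c0.
exists a; rewrite pE -[RHS]addr0; congr (_ + _).
pose h' := h - (lvar C j - lconst n d) * a.
have {}e : (lvar C j - lconst n d) * r = (lvar C i - lconst n c) * h'.
  by rewrite /h' mulrBr -e pE mulrDr mulrCA addrAC subrr add0r.
(* Shifting by e_j does not change v_i since i and j differ, so the left side of [e] has no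
   coefficient at v when v_i is nonzero. *)
have he v : v 0 i != 0 -> h' (v - delta_mx 0 i) = c * h' v.
  move=> vi; move/laurentP/(_ v): e; rewrite !lvar_sub_coef !rs //.
    by rewrite mulr0 subr0 => /esym/eqP; rewrite subr_eq0 => /eqP.
  by rewrite !mxE eqxx (negPf ij) subr0.
have h0 : h' = 0.
  (* The ray points away from the hyperplane v_i = 0: [he] is applied at i-th entries v_i + k + 1 >
     0 going up, with ratio 1/c, and v_i - k < 0 going down, with ratio c. *)
  apply/laurentP => v; rewrite lcoef0; have [vi|vi] := leP 0 (v 0 i).
    apply: (@geometric_ray_eq0 _ _ (delta_mx 0 i) c^-1); rewrite ?invr_eq0 ?delta_neq0 //.
    move=> k; rewrite -[in RHS](addrK (delta_mx 0 i) (_ *+ k)) -mulrSr addrA he ?mulKf //.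
    by rewrite !mxE mulmxnE !mxE !eqxx /= natz; lia.
  apply: (@geometric_ray_eq0 _ _ (- delta_mx 0 i) c); rewrite ?oppr_eq0 ?delta_neq0 //.
  by move=> k; rewrite mulrSr addrA he // !mxE mulmxnE !mxE !eqxx /= natz; lia.
by move: e; rewrite h0 mulr0; exact: lvar_sub_regular.
Qed.

(** Reducing one variable at a time modulo z_j - z_j(z) turns every monomial into a constant, and
    evaluation at z shows that the total constant is zero. *)
Lemma laurent_vanishing (z : torus C n) p : leval z p = 0 ->
  exists a : 'I_n -> laurent C n,
    p = \sum_j (lvar C j - lconst n (z 0 j)) * a j.
Proof.
suff [a [y pE]] : exists (a : 'I_n -> laurent C n) y,
    p = \sum_j (lvar C j - lconst n (z 0 j)) * a j + lconst n y.
  rewrite pE rmorphD rmorph_sum /= leval_lconst big1 ?add0r.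
    by move=> ->; exists a; rewrite [lconst _ _](_ : _ = 0) ?addr0 //;
      apply/laurentP => v /=; rewrite mul0rn.
  by move=> j _; rewrite rmorphM rmorphB /= leval_lvar leval_lconst subrr mul0r.
rewrite [p]laurent_sum.
elim/big_ind: _ => [|p1 p2 [a1 [y1 ->]] [a2 [y2 ->]]|v _].
- exists (fun=> 0), 0; rewrite big1 ?add0r; last by move=> j _; rewrite mulr0.
  by apply/laurentP => v /=; rewrite mul0rn.
- exists (fun j => a1 j + a2 j), (y1 + y2).
  rewrite addrACA -big_split /= -[lconst n (y1 + y2)]add_lterm; congr (_ + _).
  by apply: eq_bigr => j _; rewrite mulrDr.
move: (p v) => x; have -> : v = \sum_(j <- index_enum 'I_n) delta_mx 0 j *~ v 0 j.
  rewrite {1}[v]row_sum_delta; apply: eq_bigr => j _.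
  by rewrite -scaler_int intz.
(* Only the list in the exponent is generalized; the sum of multiples in the conclusion still runs
   over all indices. *)
move: {1}(index_enum 'I_n) => s; elim: s x => [|j s IH] x.
  exists (fun=> 0), x; rewrite big_nil big1 ?add0r //.
  by move=> j _; rewrite mulr0.
rewrite big_cons addrC.
have [b [x' ->]] := lterm_reduction j x (\sum_(i <- s) delta_mx 0 i *~ v 0 i)
  (v 0 j) (torus_neq0 z j).
have [a [y ->]] := IH x'.
exists (fun i => a i + (if i == j then b else 0)), y; rewrite addrA; congr (_ + _).
under [RHS]eq_bigr do rewrite mulrDr.
rewrite big_split /= addrC; congr (_ + _).
by rewrite (bigD1 j) //= eqxx big1 ?addr0 // => i /negPf->; rewrite mulr0.
Qed.

End LaurentRing.

(** * The cokernel of a matrix factorization and the skyscraper *)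

Section CokernelToPoint.
Context (C : fieldType) (n k : nat) (w : laurent C n) (z0 : torus C n).
Context (A : 'M[laurent C n]_k) (i0 : 'I_k).
Local Notation S := (fiber_ring w z0).
Local Notation pr := (to_fiber w z0).
Local Notation cokA := (coker (map_mx pr A)).

Lemma to_fiber_eq0 p : pr p = 0 <-> exists g, p = g * fiber_eqn w z0.
Proof.
have -> : (pr p = 0) <-> (p - 0 \in fiber_ideal w z0).
  rewrite -(raddf0 pr) /to_fiber Quotient.idealrBE.
  by split=> [e|/eqP //]; exact/eqP.
by rewrite subr0; split=> [/asboolP|?] //; exact/asboolP.
Qed.

Lemma to_fiber_surj (s : S) : exists p, s = pr p.
Proof. by exists (repr s); rewrite [to_fiber _ _ _]reprK. Qed.

Definition coord_class (v : 'cV[S]_k) : skyscraper w z0 :=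
  quotmod_pi (point_ideal_submod w z0) (v i0 0).

Lemma coord_class_linear : linear coord_class.
Proof. by move=> a u v; rewrite /coord_class !mxE linearP. Qed.

HB.instance Definition _ := GRing.isLinear.Build S 'cV[S]_k (skyscraper w z0)
  *:%R coord_class coord_class_linear.

Lemma coord_class_eq0 v :
  coord_class v = 0 <-> exists2 p, leval z0 p = 0 & v i0 0 = pr p.
Proof.
rewrite -(raddf0 coord_class) /coord_class quotmod_piP mxE subr0.
by split=> [/asboolP|?] //; exact/asboolP.
Qed.

Hypothesis row0 : forall j, leval z0 (A i0 j) = 0.

(** The [i0]-th entry of an image vector is a combination of the entries of row [i0], which vanish
    at [z0]. *)
Lemma coord_class_image v : v \in mx_image (map_mx pr A) -> coord_class v = 0.
Proof.
move=> /asboolP[u ->]; apply/coord_class_eq0.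
exists (\sum_j A i0 j * repr (u j 0)).
  by rewrite rmorph_sum big1 // => j _; rewrite rmorphM /= row0 mul0r.
rewrite mxE rmorph_sum; apply: eq_bigr => j _.
by rewrite mxE rmorphM /= [to_fiber _ _ (repr _)]reprK.
Qed.

Definition coker_to_point : {linear cokA -> skyscraper w z0} :=
  quotmod_lift (submodP := mx_image_submod (map_mx pr A)) coord_class_image.

End CokernelToPoint.

Section CokernelToPointTheory.
Context (C : fieldType) (n k : nat) (w : laurent C n) (z0 : torus C n).
Context (A : 'M[laurent C n]_k) (i0 : 'I_k).
Hypothesis row0 : forall j, leval z0 (A i0 j) = 0.
Local Notation S := (fiber_ring w z0).
Local Notation pr := (to_fiber w z0).
Local Notation cl := (quotmod_pi (mx_image_submod (map_mx pr A))).

Lemma coker_to_pointE v : coker_to_point w row0 (cl v) = coord_class i0 v.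
Proof. exact: quotmod_liftE. Qed.

Lemma coker_class_eq0 v : cl v = 0 <-> exists u, v = map_mx pr A *m u.
Proof.
rewrite -(raddf0 cl) quotmod_piP subr0.
by split=> [/asboolP|?] //; exact/asboolP.
Qed.

Lemma coker_to_point_surj y : exists x, coker_to_point w row0 x = y.
Proof.
exists (cl (const_mx (repr y))); rewrite coker_to_pointE /coord_class mxE.
exact: quotmod_piK.
Qed.

(* The entries of row i0 vanish at z0; if they generate the maximal ideal, the
   kernel of Coker(A) -> R/m comes from the vectors with zero i0-th entry. *)
Lemma coker_to_point_kernel x :
  (forall p, leval z0 p = 0 -> exists a : 'I_k -> laurent C n,
     p = \sum_j A i0 j * a j) ->
  coker_to_point w row0 x = 0 -> exists2 v, x = cl v & v i0 0 = 0.
Proof.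
move=> gen; rewrite -[x]quotmod_piK coker_to_pointE => /coord_class_eq0[p p0 vp].
have [a pE] := gen p p0; pose u := \col_j pr (a j).
(* Subtracting A u keeps the class and cancels the [i0]-th entry. *)
exists (repr x - map_mx pr A *m u).
  apply/eqP; rewrite raddfB /= [X in _ == _ - X](_ : _ = 0) ?subr0 //.
  by apply/coker_class_eq0; exists u.
rewrite !mxE vp pE rmorph_sum /=; apply/eqP; rewrite subr_eq0; apply/eqP.
by apply: eq_bigr => j _; rewrite !mxE rmorphM.
Qed.

End CokernelToPointTheory.

(** * Comparison of the cokernel with the skyscraper in dimensions one and two *)

(** The map to the skyscraper is already bijective, so [singularity_iso] applies with the zero
    module as kernel. *)
Lemma coker_point1 (C : fieldType) (w : laurent C 1) (z0 : torus C 1)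
    (A : 'M[laurent C 1]_1) :
  A 0 0 = lvar C 0 - lconst 1 (z0 0 0) ->
  @isomorphic (singularity_cat (fiber_ring w z0))
    (stalk (fin_gen_coker (map_mx (to_fiber w z0) A)))
    (stalk (fin_gen_skyscraper w z0)).
Proof.
move=> A00.
have row0 j : leval z0 (A 0 j) = 0.
  by rewrite ord1 A00 raddfB /= leval_lvar leval_lconst subrr.
have gen p : leval z0 p = 0 ->
    exists a : 'I_1 -> laurent C 1, p = \sum_j A 0 j * a j.
  by move=> /laurent_vanishing[a ->]; exists a; rewrite !big_ord1 A00.
apply: (@singularity_iso _ 'rV_0 _ _ \0 (coker_to_point w row0)).
- exact: rV0_fin_gen.
- by move=> x y _; rewrite [x]thinmx0 [y]thinmx0.
- exact: coker_to_point_surj.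
- move=> x; split=> [|[y ->]]; last exact: raddf0.
  move=> /(coker_to_point_kernel gen)[v -> v0]; exists 0.
  rewrite (_ : v = 0) ?raddf0 //; apply/matrixP => i j.
  by rewrite !ord1 mxE.
- exact: rV0_projective.
Qed.

Lemma sum_ord2 (T : nmodType) (F : 'I_2 -> T) : \sum_j F j = F 0 + F 1.
Proof.
by rewrite !big_ord_recl big_ord0 addr0; congr (_ + F _); exact/val_inj.
Qed.

Section Dimension2.
Context (C : fieldType) (w : laurent C 2) (z0 : torus C 2).
Context (A : 'M[laurent C 2]_2).
Local Notation x1 := (lvar C (0 : 'I_2) - lconst 2 (z0 0 0)).
Local Notation x2 := (lvar C (1 : 'I_2) - lconst 2 (z0 0 1)).
Local Notation S := (fiber_ring w z0).
Local Notation pr := (to_fiber w z0).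
Local Notation cl := (quotmod_pi (mx_image_submod (map_mx pr A))).

(** The second row consists of unit multiples of the generators x2 and x1 of the maximal ideal. *)
Hypothesis A10 : A 1 0 = - (x2 * lvarV C 1).
Hypothesis A11 : A 1 1 = x1 * lvarV C 0.
Hypothesis detA : A 0 0 * A 1 1 - A 0 1 * A 1 0 = fiber_eqn w z0.
Hypothesis fiberE : exists b,
  fiber_eqn w z0 = x1 * b + x2 * (x2 * lvarV C 1).

(* Modulo x1 the equation is a unit times x2 ^ 2, hence a nonzerodivisor. *)
Lemma fiber_eqn_coprime p q : x1 * p = fiber_eqn w z0 * q ->
  exists a, p = a * fiber_eqn w z0.
Proof.
have [b bE] := fiberE => pq.
have ne : (0 : 'I_2) != 1 by [].
have e1 : x2 * (x2 * (lvarV C 1 * q)) = x1 * (p - b * q).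
  by rewrite [RHS]mulrBr pq bE; ring.
(* The factor x2 is cancelled twice modulo x1; q is then a multiple of x1, and x1 can be cancelled
   from the original equation. *)
have [a1 e2] := lvar_sub_regular_mod ne (torus_neq0 z0 0) (torus_neq0 z0 1) e1.
have [a e3] := lvar_sub_regular_mod ne (torus_neq0 z0 0) (torus_neq0 z0 1) e2.
have qE : q = x1 * (lvar C 1 * a).
  by rewrite mulrCA -e3 mulrA lvarK mul1r.
exists (lvar C 1 * a); apply/eqP; rewrite -subr_eq0; apply/eqP.
apply: (@lvar_sub_regular _ _ 0 _ _ (torus_neq0 z0 0)).
by rewrite [LHS]mulrBr pq {1}qE; ring.
Qed.

(* The generators e1, e2 go to 0, 1; the kernel is generated by e1, which is free
   because the adjugate of A times A is the equation of the fiber. *)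
Lemma coker_point2 :
  @isomorphic (singularity_cat S)
    (stalk (fin_gen_coker (map_mx pr A))) (stalk (fin_gen_skyscraper w z0)).
Proof.
have x10 : leval z0 x1 = 0 by rewrite raddfB /= leval_lvar leval_lconst subrr.
have x20 : leval z0 x2 = 0 by rewrite raddfB /= leval_lvar leval_lconst subrr.
have ord2 (j : 'I_2) : j = 0 \/ j = 1.
  by case: j => [[|[|j]]] lj //; [left|right]; exact/val_inj.
have row0 j : leval z0 (A 1 j) = 0.
  have [->|->] := ord2 j; first by rewrite A10 rmorphN rmorphM /= x20 mul0r oppr0.
  by rewrite A11 rmorphM /= x10 mul0r.
have gen p : leval z0 p = 0 ->
    exists a : 'I_2 -> laurent C 2, p = \sum_j A 1 j * a j.
  move=> /laurent_vanishing[a ->].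
  (* The factors z1, z2 and the sign undo the units in the second row. *)
  exists (fun j => if j == 0 then - (lvar C 1 * a 1) else lvar C 0 * a 0).
  rewrite !sum_ord2 /= A10 A11 mulrNN addrC.
  by congr (_ + _); rewrite -[RHS]mulrA [lvarV _ _ * _]mulrCA
    [lvar _ _ * (_ * _)]mulrA lvarK mul1r.
pose g (a : S^o) : coker (map_mx pr A) := cl (a *: delta_mx 0 0).
have g_linear : linear g.
  by move=> a b c; rewrite /g scalerDl -linearP scalerA.
pose G := HB.pack_for {linear S^o -> coker (map_mx pr A)} g
  (GRing.isLinear.Build S S^o (coker (map_mx pr A)) *:%R g g_linear).
apply: (@singularity_iso _ S^o _ _ G (coker_to_point w row0)).
- exact: regular_fin_gen.
(* Suppose a e1 = A u over the quotient ring. Lifting to Laurent polynomials, the two rows become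
   equations up to multiples h1, h2 of the fiber equation. *)
- apply: raddf_inj => a /coker_class_eq0[u uE].
  have [p0 ap] := to_fiber_surj a; have [p1 u0] := to_fiber_surj (u 0 0).
  have [p2 u1] := to_fiber_surj (u 1 0).
  have [h1 e1] : exists h, p0 - (A 0 0 * p1 + A 0 1 * p2) = h * fiber_eqn w z0.
    apply/to_fiber_eq0; have /matrixP/(_ 0 0) := uE.
    rewrite !mxE sum_ord2 !mxE !eqxx mulr1 ap u0 u1 => e.
    by rewrite rmorphB rmorphD !rmorphM /= e subrr.
  have [h2 e2] : exists h, A 1 0 * p1 + A 1 1 * p2 = h * fiber_eqn w z0.
    apply/to_fiber_eq0; have /matrixP/(_ 1 0) := uE.
    rewrite !mxE sum_ord2 !mxE mulr0 u0 u1 => e.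
    by rewrite rmorphD !rmorphM /= e.
  (* Multiply the first row by A11 and eliminate A11 p2 with the second: the determinant appears in
     front of p1, so A11 p0 is the fiber equation times A11 h1 + p1 + A01 h2. The factor z1 turns
     A11 into x1. *)
  have [|c pc] := @fiber_eqn_coprime p0 (lvar C 0 * (A 1 1 * h1 + p1 + A 0 1 * h2)).
    have -> : x1 * p0 = lvar C 0 * (A 1 1 * p0).
      by rewrite A11 -[LHS]mul1r -{1}(lvarK C (0 : 'I_2)); ring.
    have -> : p0 = h1 * fiber_eqn w z0 + (A 0 0 * p1 + A 0 1 * p2) by rewrite -e1 subrK.
    have e3 : A 1 1 * p2 = h2 * fiber_eqn w z0 - A 1 0 * p1 by rewrite -e2; ring.
    transitivity (lvar C 0 * (A 1 1 * h1 * fiber_eqn w z0 + A 0 0 * A 1 1 * p1 +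
                              A 0 1 * (A 1 1 * p2))); first by ring.
    by rewrite e3 -detA; ring.
  by rewrite ap; apply/to_fiber_eq0; exists c.
- exact: coker_to_point_surj.
- move=> x; split=> [|[y ->]].
    move=> /(coker_to_point_kernel gen)[v -> v0]; exists (v 0 0).
    rewrite /= /g; congr (cl _); apply/matrixP => i j.
    rewrite [j]ord1 !mxE eqxx andbT.
    by have [->|->] := ord2 i; rewrite ?mulr1 // mulr0.
  apply: etrans (coker_to_pointE row0 (y *: delta_mx 0 0)) _.
  apply/coord_class_eq0; exists 0.
    exact: raddf0.
  by rewrite raddf0 !mxE mulr0.
- exact: regular_projective.
Qed.

End Dimension2.

(** * The matrix factorizations *)

Section Potentials.
Context (R : realType).
Local Notation C := R[i].

Lemma lconstM n (a b : C) : lconst n (a * b) = lconst n a * lconst n b.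
Proof. by rewrite mul_lterm addr0. Qed.

Lemma lconstD n (a b : C) : lconst n (a + b) = lconst n a + lconst n b.
Proof. by rewrite add_lterm. Qed.

Lemma potential1E (q : R) :
  potential 1 q = lvar C 0 + lconst 1 q%:C * lvarV C 0.
Proof.
rewrite /potential big_ord1 mul_lterm mulr1 add0r; congr (_ + lterm _ _).
by apply/rowP => j; rewrite !ord1 !mxE !eqxx.
Qed.

Lemma potential2E (q : R) :
  potential 2 q = lvar C 0 + lvar C 1 + lconst 2 q%:C * (lvarV C 0 * lvarV C 1).
Proof.
rewrite /potential sum_ord2 !mul_lterm !mulr1 add0r; congr (_ + lterm _ _).
by apply/rowP => -[[|[|j]]] lj //; rewrite !mxE.
Qed.

Lemma potential1_fiber (q c : R) (z : torus C 1) : c != 0 -> c ^+ 2 = q ->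
  z 0 0 = c%:C ->
  fiber_eqn (potential 1 q) z =
  (lvar C 0 - lconst 1 c%:C) * (1 - lconst 1 c%:C * lvarV C 0).
Proof.
move=> c0 cq zc; have c0' : c%:C != 0 by rewrite eq_complex /= (negPf c0).
rewrite /fiber_eqn potential1E -cq expr2 rmorphM /= lconstM.
rewrite rmorphD rmorphM rmorphM /= leval_lvar leval_lvarV !leval_lconst zc mulfK //.
rewrite lconstD.
set z1 := lvar C 0; set v1 := lvarV C 0; set k := lconst 1 _.
(* The product z1 v1 is isolated because [ring] does not know that v1 inverts z1. *)
transitivity (z1 - k - k * (z1 * v1) + k * k * v1); last by ring.
by rewrite lvarK; ring.
Qed.

(** With c a cube root of q the critical value is 3c. The form f1 g1 + f2 g2 is the one behind the
    Koszul shape of [M0_P2], whose lower left block is the adjugate of the upper right one. *)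
Lemma potential2_fiber (q c : R) (z : torus C 2) : c != 0 -> c ^+ 3 = q ->
  z 0 0 = c%:C -> z 0 1 = c%:C ->
  fiber_eqn (potential 2 q) z =
  (lvar C 0 - lconst 2 c%:C) * (1 - lconst 2 c%:C * lvarV C 0) +
  (lvar C 1 - lconst 2 (c ^+ 2)%:C * lvarV C 0) * (1 - lconst 2 c%:C * lvarV C 1).
Proof.
move=> c0 cq zc1 zc2; have c0' : c%:C != 0 by rewrite eq_complex /= (negPf c0).
rewrite /fiber_eqn potential2E -cq !exprS expr0 mulr1 !rmorphM /= !lconstM.
rewrite !rmorphD !rmorphM /= !leval_lvar !leval_lvarV !leval_lconst zc1 zc2.
rewrite [X in lconst 2 (_ + _ + X)](_ : _ = c%:C); last by field.
rewrite !lconstD.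
set z1 := lvar C 0; set v1 := lvarV C 0; set k := lconst 2 _.
set z2 := lvar C 1; set v2 := lvarV C 1.
transitivity (z1 + z2 - k - k * (z1 * v1) - k * (z2 * v2) + k * k * k * (v1 * v2));
  last by ring.
by rewrite !lvarK; ring.
Qed.

End Potentials.

Section Factorizations.
Context (R : realType).
Local Notation C := R[i].

Lemma M0_P1_square (q c : R) (z : torus C 1) : 0 < c -> c ^+ 2 = q ->
  z 0 0 = c%:C ->
  M0_P1 q *m M0_P1 q = (fiber_eqn (potential 1 q) z)%:M.
Proof.
move=> c0 cq zc; rewrite (potential1_fiber (lt0r_neq0 c0) cq zc).
have sq : Num.sqrt q = c by rewrite -cq sqrtr_sqr gtr0_norm.
apply/matrixP => -[[|[|i]]] li // -[[|[|j]]] lj //;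
  rewrite !mxE !big_ord_recl big_ord0 !mxE /= sq ?mulr0n ?mulr1n; ring.
Qed.

Lemma M0_P1_corresponds (q c : R) (z : torus C 1) : 0 < c -> c ^+ 2 = q ->
  z 0 0 = c%:C -> corresponds_to_point (potential 1 q) (M0_P1 q) z.
Proof.
move=> c0 cq zc; split; first split.
- by apply/matrixP => -[[|i]] li // -[[|j]] lj //; rewrite !mxE.
- by apply/matrixP => -[[|i]] li // -[[|j]] lj //; rewrite !mxE.
- exact: M0_P1_square zc.
- apply: coker_point1; rewrite !mxE /= zc.
  by rewrite -cq sqrtr_sqr gtr0_norm.
Qed.

Lemma M0_P2_square (q c : R) (z : torus C 2) : 0 < c -> c ^+ 3 = q ->
  q `^ (1 / 3) = c -> q `^ (2 / 3) = c ^+ 2 -> z 0 0 = c%:C -> z 0 1 = c%:C ->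
  M0_P2 q *m M0_P2 q = (fiber_eqn (potential 2 q) z)%:M.
Proof.
move=> c0 cq q1 q2 zc1 zc2.
rewrite (potential2_fiber (lt0r_neq0 c0) cq zc1 zc2).
apply/matrixP => -[[|[|[|[|i]]]]] li // -[[|[|[|[|j]]]]] lj //;
  rewrite !mxE !big_ord_recl big_ord0 !mxE /= ?q1 ?q2 ?mulr0n ?mulr1n; ring.
Qed.

Lemma M0_P2_corresponds (q c : R) (z : torus C 2) : 0 < c -> c ^+ 3 = q ->
  q `^ (1 / 3) = c -> q `^ (2 / 3) = c ^+ 2 -> z 0 0 = c%:C -> z 0 1 = c%:C ->
  corresponds_to_point (potential 2 q) (M0_P2 q) z.
Proof.
move=> c0 cq q1 q2 zc1 zc2; split; first split.
- by apply/matrixP => -[[|[|i]]] li // -[[|[|j]]] lj //; rewrite !mxE.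
- by apply/matrixP => -[[|[|i]]] li // -[[|[|j]]] lj //; rewrite !mxE.
- exact: M0_P2_square zc1 zc2.
- have k2 : lconst 2 (c ^+ 2)%:C = lconst 2 c%:C * lconst 2 c%:C.
    by rewrite expr2 rmorphM /= lconstM.
  have e j : 1 - lconst 2 c%:C * lvarV C j = (lvar C j - lconst 2 c%:C) * lvarV C j.
    by rewrite mulrBl lvarK.
  apply: coker_point2; rewrite ?zc1 ?zc2 ?(potential2_fiber (lt0r_neq0 c0) cq zc1 zc2).
  + by rewrite !mxE /= q1 e.
  + by rewrite !mxE /= q1 e.
  + by rewrite !mxE /= q1 q2; ring.
  + rewrite k2 !e.
    (* Since z2 - c^2/z1 = x2 + c x1/z1, the fiber equation is x1 (x1/z1) + (x2 + c x1/z1) x2/z2;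
       the witness collects the terms divisible by x1. *)
    exists (lvarV C 0 * (lvar C 0 - lconst 2 c%:C) +
            lconst 2 c%:C * lvarV C 0 * ((lvar C 1 - lconst 2 c%:C) * lvarV C 1)).
    have z2E : lvar C 1 - lconst 2 c%:C * lconst 2 c%:C * lvarV C 0 =
      (lvar C 1 - lconst 2 c%:C) + lconst 2 c%:C * (1 - lconst 2 c%:C * lvarV C 0).
      by ring.
    by rewrite z2E e; ring.
Qed.

End Factorizations.

(** * The SYZ transformation *)

Section Transform.
Context (R : realType).
Local Notation C := R[i].

Lemma rv1_eq (a b : int) : (rv1 a == rv1 b) = (a == b).
Proof.
apply/eqP/eqP => [/rowP/(_ 0)|-> //]; by rewrite !mxE.
Qed.

Lemma rv2_eq (a b c d : int) : (rv2 a b == rv2 c d) = (a == c) && (b == d).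
Proof.
apply/eqP/andP => [/rowP e|[/eqP-> /eqP-> //]].
by have := e 0; have := e 1; rewrite !mxE /= => -> ->.
Qed.

Lemma expi0 : expi (0 : R) = 1.
Proof. by rewrite /expi cos0 sin0. Qed.

Lemma expiN (a : R) : expi (- a) = (expi a)^-1.
Proof.
apply: (mulIf (expi_neq0 a)); rewrite mulVf ?expi_neq0 //.
rewrite /expi cosN sinN; apply/eqP; rewrite eq_complex /=.
rewrite !mulNr opprK -!expr2 cos2Dsin2 eqxx /=.
by rewrite [sin a * _]mulrC subrr.
Qed.

Lemma pairing1 (a : int) (y : 'rV[R]_1) : pairing (rv1 a) y = a%:~R * y 0 0.
Proof. by rewrite /pairing big_ord1 mxE. Qed.

Lemma pairing2 (a b : int) (y : 'rV[R]_2) :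
  pairing (rv2 a b) y = a%:~R * y 0 0 + b%:~R * y 0 1.
Proof. by rewrite /pairing sum_ord2 !mxE. Qed.

Lemma syz_transform_seq n k (Psi : 'rV[R]_n -> 'rV[int]_n -> 'M[C]_k) x y s :
  uniq s -> (forall v, v \notin s -> Psi x v = 0) ->
  syz_transform Psi x y = \sum_(v <- s) expi (pairing v y) *: Psi x v.
Proof.
by move=> us sP; apply: fsum_seq => // v /sP ->; rewrite scaler0.
Qed.

Lemma syz_term n (x y : 'rV[R]_n) j :
  expi (y 0 j) * (expR (- x 0 j))%:C = syz_point x y 0 j.
Proof. by rewrite mxE mulrC. Qed.

Lemma syz_termV n (x y : 'rV[R]_n) j (k : C) :
  expi (- y 0 j) * (k * ((expR (- x 0 j))^-1)%:C) = k / syz_point x y 0 j.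
Proof. by rewrite mxE expiN fmorphV mulrCA invfM [X in _ * X]mulrC. Qed.

Lemma syz_transform_P1 (t : R) (x y : 'rV[R]_1) :
  syz_transform (PsiP1 t) x y = map_mx (leval (syz_point x y)) (M0_P1 (expR (- t))).
Proof.
rewrite (@syz_transform_seq _ _ _ _ _ [:: rv1 1; rv1 0; rv1 (-1)]).
(* The mirror point is generalized together with its two coordinate equations, so that [mxE] does
   not unfold it. *)
- rewrite !big_cons big_nil; move: (syz_point x y) (syz_term x y) (syz_termV x y) => z zE zVE.
  apply/matrixP => -[[|[|i]]] li // -[[|[|j]]] lj //; rewrite !mxE /= ?psiP1E /=;
    rewrite ?rv1_eq ?pairing1 /= ?(rmorphB, rmorphM, rmorph1, rmorph0) /=
    ?leval_lvar ?leval_lvarV ?leval_lconst ?mulr0 ?addr0 //.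
  + rewrite mul1r mul0r expi0 mul1r.
    by rewrite zE rmorphN.
  + by rewrite add0r mul0r expi0 !mul1r mulN1r rmorphN rmorphM /= mulrN zVE.
- by rewrite /= !inE !rv1_eq.
- move=> v; rewrite !inE !negb_or => /and3P[/negPf v1 /negPf v0 /negPf vN].
  by apply/matrixP => -[[|[|i]]] li // -[[|[|j]]] lj //;
    rewrite !mxE /= ?psiP1E /= ?v1 ?v0 ?vN.
Qed.

Lemma syz_transform_P2 (t : R) (x y : 'rV[R]_2) :
  syz_transform (PsiP2 t) x y = map_mx (leval (syz_point x y)) (M0_P2 (expR (- t))).
Proof.
pose s := [:: rv2 1 0; rv2 0 1; rv2 0 0; rv2 (-1) 0; rv2 0 (-1)] : seq 'rV[int]_2.
rewrite (@syz_transform_seq _ _ _ _ _ s).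
- rewrite !big_cons big_nil; move: (syz_point x y) (syz_term x y) (syz_termV x y) => z zE zVE.
  have p10 : expi (pairing (rv2 1 0) y) = expi (y 0 0).
    by rewrite pairing2 mul1r mul0r addr0.
  have p01 : expi (pairing (rv2 0 1) y) = expi (y 0 1).
    by rewrite pairing2 mul1r mul0r add0r.
  have p00 : expi (pairing (rv2 0 0) y) = 1.
    by rewrite pairing2 !mul0r add0r expi0.
  have pN0 : expi (pairing (rv2 (-1) 0) y) = expi (- y 0 0).
    by rewrite pairing2 mulN1r mul0r addr0.
  have p0N : expi (pairing (rv2 0 (-1)) y) = expi (- y 0 1).
    by rewrite pairing2 mulN1r mul0r add0r.
  apply/matrixP => -[[|[|[|[|i]]]]] li // -[[|[|[|[|j]]]]] lj //;
    rewrite !mxE /= /psiP2 /= ?rv2_eq /= ?p10 ?p01 ?p00 ?pN0 ?p0N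
    ?(rmorphB, rmorphM, rmorph1, rmorph0, rmorphN) /=
    ?leval_lvar ?leval_lvarV ?leval_lconst ?mulr0 ?addr0 ?add0r ?mulrN
    ?zVE ?zE ?mul1r ?opprD ?opprK ?mulNr ?opprK //.
- by rewrite /s /= !inE !rv2_eq.
- move=> v; rewrite /s !inE !negb_or.
  move=> /and5P[/negPf v10 /negPf v01 /negPf v00 /negPf vN0 /negPf v0N].
  by apply/matrixP => -[[|[|[|[|i]]]]] li // -[[|[|[|[|j]]]]] lj //;
    rewrite !mxE /= ?/psiP2 /= ?v10 ?v01 ?v00 ?vN0 ?v0N.
Qed.

End Transform.

(** * Centers of mass *)

Section CenterOfMass.
Context (R : realType).
Local Notation mu := (@lebesgue_measure R).

Lemma continuous_horner (p : {poly R}) : continuous (horner p).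
Proof.
move=> x; apply: differentiable_continuous; apply/derivable1_diffP.
exact: derivable_horner.
Qed.

Lemma integral_deriv_poly (p : {poly R}) (t : R) : 0 < t ->
  (\int[mu]_(x in `[0%R, t]) (p^`().[x])%:E = (p.[t] - p.[0])%:E)%E.
Proof.
move=> t0; rewrite (@continuous_FTC2 _ (horner p^`()) (horner p)) //.
- exact/continuous_subspaceT/continuous_horner.
- split=> [x _||]; first exact: derivable_horner.
  + exact/cvg_at_right_filter/continuous_horner.
  + exact/cvg_at_left_filter/continuous_horner.
- by move=> x _; rewrite -derivE.
Qed.

Definition triangle (t : R) : set (R * R) :=
  [set z | [/\ 0 <= z.1, 0 <= z.2 & z.1 + z.2 <= t]].

Lemma measurable_triangle t : measurable (triangle t).
Proof.
have -> : triangle t = ([set: R * R] `&` [set z | 0 <= z.1]) `&`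
    (setT `&` [set z | 0 <= z.2]) `&` (setT `&` [set z | z.1 + z.2 <= t]).
  rewrite !setTI; apply/seteqP.
  by split=> [z [z1 z2 zt]|z [[z1 z2] zt]]; split=> //; split.
apply: measurableI; first apply: measurableI.
- exact: measurable_fun_le.
- exact: measurable_fun_le.
- by apply: measurable_fun_le => //; exact: measurable_funD.
Qed.

(** The slice is given by an equivalence so that horizontal and vertical slices of the triangle are
    both covered. *)
Lemma integral_slice (t x c : R) (D : set R) : 0 <= c ->
  (forall y, D y <-> [/\ 0 <= x, 0 <= y & x + y <= t]) ->
  (\int[mu]_(y in D) c%:E =
   if x \in `[0%R, t]%classic then (c * (t - x))%:E else 0)%E.
Proof.
move=> c0 Dy; case: ifPn => [/set_mem|/negP xt].
  rewrite /= in_itv /= => /andP[x0 xt].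
  have -> : D = `[0, t - x]%classic.
    apply/seteqP; split=> y /=; rewrite in_itv /= lerBrDl.
      by move=> /(Dy y).1[_ -> ->].
    by move=> /andP[? ?]; apply/(Dy y).2.
  rewrite integral_cst //= lebesgue_measure_itv /= lte_fin; case: ltP => [_|tx].
    by rewrite -EFinD -EFinM subr0.
  (* Degenerate slice x = t, a single point: both sides are 0. *)
  by rewrite mule0 (_ : t - x = 0) ?mulr0 //; apply/eqP; rewrite eq_le tx subr_ge0.
rewrite (_ : D = set0) ?integral_set0 //; apply/seteqP; split=> // y.
move=> /(Dy y).1[x0 y0 xy]; apply: xt; apply/mem_set; rewrite /= in_itv /= x0.
by apply: le_trans xy; rewrite lerDl.
Qed.

Section TriangleIntegral.
Context (t : R) (p : {poly R}).
Hypotheses (t0 : 0 < t) (p0 : forall x, 0 <= x -> 0 <= p.[x]).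

(** Tonelli, slicing at fixed first coordinate. Taking p = 1 yields the area and p = X the first
    moment. *)
Lemma integral_triangle1 :
  (\int[mu \x mu]_(z in triangle t) (p.[z.1])%:E =
   \int[mu]_(x in `[0%R, t]) (p.[x] * (t - x))%:E)%E.
Proof.
rewrite integral_mkcond fubini_tonelli1 //; last 2 first.
- apply/(measurable_restrictT _ (measurable_triangle t)).
  apply: measurable_funTS; apply/measurable_EFinP.
  apply: (measurableT_comp (f := horner p)) => //.
  by apply: continuous_measurable_fun; exact: continuous_horner.
- by apply: erestrict_ge0 => z [z1 _ _]; rewrite lee_fin p0.
rewrite [RHS]integral_mkcond; apply: eq_integral => x _; rewrite /fubini_F.
have [x0|x0] := leP 0 x; last first.
  rewrite patchE ifF; last by apply/negbTE/negP => /set_mem; rewrite /= in_itv /= leNgt x0.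
  rewrite integral0_eq // => y _; rewrite patchE ifF //.
  by apply/negbTE/negP => /set_mem[/=]; rewrite leNgt x0.
rewrite [RHS]patchE -(@integral_slice t x p.[x] [set y | triangle t (x, y)]) ?p0 //.
by rewrite [RHS]integral_mkcond; apply: eq_integral => y _; rewrite !patchE.
Qed.

Lemma integral_triangle2 :
  (\int[mu \x mu]_(z in triangle t) (p.[z.2])%:E =
   \int[mu]_(x in `[0%R, t]) (p.[x] * (t - x))%:E)%E.
Proof.
rewrite integral_mkcond fubini_tonelli2 //; last 2 first.
- apply/(measurable_restrictT _ (measurable_triangle t)).
  apply: measurable_funTS; apply/measurable_EFinP.
  apply: (measurableT_comp (f := horner p)) => //.
  by apply: continuous_measurable_fun; exact: continuous_horner.
- by apply: erestrict_ge0 => z [_ z2 _]; rewrite lee_fin p0.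
rewrite [RHS]integral_mkcond; apply: eq_integral => x _; rewrite /fubini_G.
have [x0|x0] := leP 0 x; last first.
  rewrite patchE ifF; last by apply/negbTE/negP => /set_mem; rewrite /= in_itv /= leNgt x0.
  rewrite integral0_eq // => y _; rewrite patchE ifF //.
  by apply/negbTE/negP => /set_mem[/= _]; rewrite leNgt x0.
rewrite [RHS]patchE -(@integral_slice t x p.[x] [set y | triangle t (y, x)]) ?p0 //.
  by rewrite [RHS]integral_mkcond; apply: eq_integral => y _; rewrite !patchE.
by move=> y; rewrite /triangle /=; split=> -[? ? ?]; split=> //; rewrite addrC.
Qed.

End TriangleIntegral.

Lemma integral_deriv_polyE (p : {poly R}) (f : R -> R) (t : R) : 0 < t ->
  (forall x, p^`().[x] = f x) ->
  (\int[mu]_(x in `[0%R, t]) (f x)%:E = (p.[t] - p.[0])%:E)%E.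
Proof.
by move=> t0 pf; rewrite -integral_deriv_poly //; apply: eq_integral => x _; rewrite pf.
Qed.

Lemma center_of_mass1E (t : R) : 0 < t ->
  center_of_mass1 (polytope 1 t) = rv1 (t / 2).
Proof.
move=> t0; rewrite /center_of_mass1.
have -> : [set s | polytope 1 t (rv1 s)] = `[0, t]%classic.
  apply/seteqP; split=> s; rewrite /polytope /= in_itv /= big_ord1 mxE.
    by move=> [/(_ 0)]; rewrite mxE => -> ->.
  by move=> /andP[s0 ->]; split=> // j; rewrite mxE.
rewrite lebesgue_measure_itv /= lte_fin t0 /Rintegral.
rewrite (@integral_deriv_polyE (2^-1 *: 'X^2) (fun x => x)) //; last first.
  by move=> x; rewrite derivZ derivXn !hornerE /=; field.
rewrite !hornerE /= subr0; congr rv1; field.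
by rewrite gt_eqF.
Qed.

Lemma center_of_mass2E (t : R) : 0 < t ->
  center_of_mass2 (polytope 2 t) = rv2 (t / 3) (t / 3).
Proof.
move=> t0; rewrite /center_of_mass2.
have -> : [set s | polytope 2 t (rv2 s.1 s.2)] = triangle t.
  apply/seteqP; split=> -[a b]; rewrite /polytope /triangle /= sum_ord2 !mxE /=.
    by move=> [s0 ->]; have := s0 0; have := s0 1; rewrite !mxE /= => -> ->.
  by move=> [a0 b0 ->]; split=> // j; rewrite mxE; case: ifP.
have mE : ((mu \x mu) (triangle t) = (t ^+ 2 / 2)%:E)%E.
  transitivity (\int[mu \x mu]_(z in triangle t) ((1 : {poly R}).[z.1])%:E)%E.
    under eq_integral do rewrite hornerC.
    by rewrite integral_cst ?mul1e //; exact: measurable_triangle.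
  rewrite integral_triangle1 //; last by move=> x _; rewrite hornerC.
  rewrite (@integral_deriv_polyE (t *: 'X - 2^-1 *: 'X^2)) //.
    by rewrite !hornerE /=; congr EFin; field.
  by move=> x; rewrite derivB !derivZ derivXn derivX !hornerE /=; field.
(* The common value of both first moments; divided by the area t^2/2 it gives t/3. *)
have I3 : (\int[mu]_(x in `[0%R, t]) ('X.[x] * (t - x))%:E = (t ^+ 3 / 6)%:E)%E.
  rewrite (@integral_deriv_polyE ((t / 2) *: 'X^2 - 3^-1 *: 'X^3)) //.
    by rewrite !hornerE /=; congr EFin; field.
  by move=> x; rewrite derivB !derivZ !derivXn !hornerE /=; field.
have e : t ^+ 3 / 6 / (t ^+ 2 / 2) = t / 3 by field; rewrite gt_eqF.
have I1 : \int[(mu \x mu)%E]_(s in triangle t) s.1 = t ^+ 3 / 6.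
  rewrite /Rintegral -[RHS]/(fine (t ^+ 3 / 6)%:E) -I3 -integral_triangle1 //.
    by congr fine; apply: eq_integral => z _; rewrite hornerX.
  by move=> x; rewrite hornerX.
have I2 : \int[(mu \x mu)%E]_(s in triangle t) s.2 = t ^+ 3 / 6.
  rewrite /Rintegral -[RHS]/(fine (t ^+ 3 / 6)%:E) -I3 -integral_triangle2 //.
    by congr fine; apply: eq_integral => z _; rewrite hornerX.
  by move=> x; rewrite hornerX.
by rewrite mE I1 I2 /= e.
Qed.

End CenterOfMass.

(** * The central fiber and its mirror point *)

Section MirrorPoint.
Context (R : realType).
Local Notation C := R[i].

(** The ball of radius e in the sup norm stays inside: each coordinate moves by less than e. *)
Lemma interior_polytope n (t e : R) (x : 'rV[R]_n) : 0 < e ->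
  (forall j, e <= x 0 j) -> \sum_j (x 0 j + e) <= t -> interior (polytope n t) x.
Proof.
move=> e0 ex xt; apply/nbhs_ballP; exists e => //= y yx.
have {}yx j : `|x 0 j - y 0 j| < e by have [_ /(_ 0 j)] := yx; rewrite -ball_normE.
split=> [j|].
  by move: (yx j) (ex j); rewrite ltr_norml => /andP[_]; lra.
apply: le_trans xt; apply: ler_sum => j _.
by move: (yx j); rewrite ltr_norml => /andP[]; lra.
Qed.

Lemma syz_point0 n (x : 'rV[R]_n) j : syz_point x 0 0 j = (expR (- x 0 j))%:C.
Proof. by rewrite !mxE expi0 mulr1. Qed.

Lemma normc_real (a : R) : 0 < a -> `|a%:C| = a%:C.
Proof. by move=> a0; rewrite gtr0_norm // ltcR. Qed.

Lemma expR_third (t : R) : expR (- (t / 3)) ^+ 3 = expR (- t).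
Proof. by rewrite -expRM_natl; congr expR; field. Qed.

Lemma expR_half (t : R) : expR (- (t / 2)) ^+ 2 = expR (- t).
Proof. by rewrite -expRM_natl; congr expR; field. Qed.

Lemma sqrt_expR (t : R) : Num.sqrt (expR (- t)) = expR (- (t / 2)).
Proof. by rewrite -expR_half sqrtr_sqr gtr0_norm ?expR_gt0. Qed.

Lemma expR_powR_third (t : R) : expR (- t) `^ (1 / 3) = expR (- (t / 3)).
Proof. by rewrite -expRM; congr expR; field. Qed.

Lemma expR_powR_two_thirds (t : R) : expR (- t) `^ (2 / 3) = expR (- (t / 3)) ^+ 2.
Proof. by rewrite -expRM -expRM_natl; congr expR; field. Qed.

Lemma mirror_P1 (t : R) : 0 < t -> mirror_to_brane t (M0_P1 (expR (- t))) (rv1 (t / 2)) 0.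
Proof.
move=> t0; have zE : syz_point (rv1 (t / 2)) 0 0 0 = (expR (- (t / 2)))%:C.
  by rewrite syz_point0 mxE.
split.
- by apply: (@interior_polytope _ _ (t / 4)) => [|j|]; rewrite ?big_ord1 ?mxE; lra.
- split=> [j|]; rewrite ?big_ord1 ?ord1 zE normc_real ?expR_gt0 // ltcR
    ?ltr_expR ?expR_lt1; lra.
- exact: (M0_P1_corresponds (expR_gt0 _) (expR_half t) zE).
Qed.

Lemma mirror_P2 (t : R) : 0 < t ->
  mirror_to_brane t (M0_P2 (expR (- t))) (rv2 (t / 3) (t / 3)) 0.
Proof.
move=> t0; have zE j : syz_point (rv2 (t / 3) (t / 3)) 0 0 j = (expR (- (t / 3)))%:C.
  by rewrite syz_point0 mxE; case: ifP.
have xE j : (rv2 (t / 3) (t / 3)) 0 j = t / 3 by rewrite mxE; case: ifP.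
split.
(* The radius t/6 is the largest allowed by the slanted edge: 2 (t/3 + t/6) = t. *)
- by apply: (@interior_polytope _ _ (t / 6)) => [|j|]; rewrite ?sum_ord2 ?xE; lra.
- split=> [j|].
    rewrite zE normc_real ?expR_gt0 // ltcR expR_lt1; lra.
  rewrite !big_ord_recl big_ord0 mulr1 !zE -rmorphM /= -expRD normc_real ?expR_gt0 //.
  rewrite ltcR ltr_expR; lra.
- exact: (M0_P2_corresponds (expR_gt0 _) (expR_third t) (expR_powR_third t)
    (expR_powR_two_thirds t) (zE 0) (zE 1)).
Qed.

End MirrorPoint.

Theorem theorem1p1 (R : realType) (t : R) (ht : 0 < t) :
  let q : R := expR (- t) in
  (* X = P^1 *)
  (let W := potential 1 q in
   let x0 := center_of_mass1 (polytope 1 t) in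
   let z0 := rv1 (Num.sqrt q)%:C in
   [/\ forall x y : 'rV[R]_1, regionP1 t x ->
         syz_transform (PsiP1 t) x y =
         map_mx (leval (syz_point x y)) (M0_P1 q),
       M0_P1 q *m M0_P1 q = (W - lconst 1 (leval z0 W))%:M,
       tpoint (syz_point x0 0) = z0
     & mirror_to_brane t (M0_P1 q) x0 0]) /\
  (* X = P^2 *)
  (let W := potential 2 q in
   let x0 := center_of_mass2 (polytope 2 t) in
   let z0 := rv2 (q `^ (1 / 3))%:C (q `^ (1 / 3))%:C in
   [/\ forall x y : 'rV[R]_2, regionP2 t x ->
         syz_transform (PsiP2 t) x y =
         map_mx (leval (syz_point x y)) (M0_P2 q),
       M0_P2 q *m M0_P2 q = (W - lconst 2 (leval z0 W))%:M,
       tpoint (syz_point x0 0) = z0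
     & mirror_to_brane t (M0_P2 q) x0 0]).
Proof.
move=> q; split=> W x0 z0.
  have x0E : x0 = rv1 (t / 2) by exact: center_of_mass1E.
  have zE : tpoint (syz_point x0 0) = z0.
    apply/rowP => j; rewrite ord1 syz_point0 x0E !mxE.
    by rewrite /q sqrt_expR.
  have Mm : mirror_to_brane t (M0_P1 q) x0 0 by rewrite x0E; exact: mirror_P1.
  split=> //; first by move=> x y _; exact: syz_transform_P1.
  (* The square identity is part of the factorization at the mirror point, which [zE] identifies
     with the explicit [z0]. *)
  by case: Mm => _ _ [[_ _]]; rewrite zE.
have x0E : x0 = rv2 (t / 3) (t / 3) by exact: center_of_mass2E.
have zE : tpoint (syz_point x0 0) = z0.
  apply/rowP => j; rewrite syz_point0 x0E !mxE /q expR_powR_third.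
  by case: ifP.
have Mm : mirror_to_brane t (M0_P2 q) x0 0 by rewrite x0E; exact: mirror_P2.
split=> //; first by move=> x y _; exact: syz_transform_P2.
by case: Mm => _ _ [[_ _]]; rewrite zE.
Qed.
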